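(* Let $M$ be a matroid on $[n]$ of rank $d$. Suppose that $\mathcal{D}$ and $\mathcal{D}'$ are two polyhedral subdivisions of $\mathrm{Poly}_M$, both of which have the property that all their interior faces correspond to direct sums of series-parallel matroids. Then $\mathcal{D}$ and $\mathcal{D}'$ have the same number of interior faces of each dimension.
   Context: For a matroid $M$ on $[n]=\{1,\dots,n\}$ of rank $d$, $\mathrm{Poly}_M\subset\mathbb{R}^n$ is the convex hull of the vectors $e_{i_1}+\cdots+e_{i_d}$, where $\{i_1,\dots,i_d\}$ runs over the bases of $M$. A face $F$ of a subdivision of $\mathrm{Poly}_M$ corresponds to a matroid $N$ on $[n]$ if $F=\mathrm{Poly}_N$. An interior face of a subdivision of $\mathrm{Poly}_M$ is a face (of any dimension, including the maximal ones) not contained in the boundary (relative to the affine span) of $\mathrm{Poly}_M$. A matroid is series-parallel if it can be obtained from the uniform matroid of rank $1$ on $2$ elements by repeated series and parallel extensions. Here the parallel extension of $M$ at a (non-loop) element $e$ adds one new element parallel to $e$, and the series extension of $M$ at $e$ is the dual of the parallel extension at $e$ of the dual matroid of $M$. A direct sum of series-parallel matroids may have any number $\ge1$ of summands. *)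

(* Defs.v *)
From HB Require Import structures.
From mathcomp Require Import all_boot all_order all_algebra.

Set Implicit Arguments.
Unset Strict Implicit.
Unset Printing Implicit Defensive.

Import Order.TTheory GRing.Theory Num.Theory.

(* Matroids on a finite ground set, given by their bases. [{set E}] is the    *)
(* type of finite sets of finset.v; [set V] (used for subsets of R^n) is the  *)
(* type of classical sets of classical_sets.v.                                *)

Definition basis_exchange (E : finType) (BB : {set {set E}}) : Prop :=
  forall B1 B2 x, B1 \in BB -> B2 \in BB -> x \in B1 :\: B2 ->
    exists2 y, y \in B2 :\: B1 & y |: (B1 :\ x) \in BB.

Record matroid (E : finType) := Matroid {
  bases : {set {set E}};
  bases_neq0 : bases != set0;
  bases_exchange : basis_exchange bases }.

(* All bases have the same cardinality, see [card_bases]. *)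
Definition matroid_rank (E : finType) (M : matroid E) : nat :=
  \max_(B in bases M) #|B|.

Definition is_loop (E : finType) (M : matroid E) (e : E) : bool :=
  [forall B in bases M, e \notin B].

Definition matroid_iso (E F : finType) (M : matroid E) (N : matroid F) : Prop :=
  exists2 f : E -> F, bijective f &
    bases N = [set f @: (B : {set E}) | B in bases M].

Section Exchange.
Variables (E : finType) (M : matroid E).
Implicit Types A B : {set E}.

Lemma card_bases B1 B2 : B1 \in bases M -> B2 \in bases M -> #|B1| = #|B2|.
Proof.
move=> + hB2; have [k] := ubnP #|B1 :\: B2|.
elim: k B1 => // k IH B1 + hB1.
case: (set_0Vmem (B1 :\: B2)) => [B12|[x xB] lek].
  move=> _; suff -> : B1 = B2 by [].
  apply/eqP; rewrite eqEsubset -setD_eq0 B12 eqxx /=.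
  rewrite -setD_eq0; apply/negPn/negP => /set0Pn[x xB].
  by have [y] := bases_exchange hB2 hB1 xB; rewrite B12 in_set0.
have [y yB hy] := bases_exchange hB1 hB2 xB.
move: (xB) (yB); rewrite !inE => /andP[xNB2 xB1] /andP[yNB1 yB2].
have <- : #|y |: B1 :\ x| = #|B1|.
  by rewrite cardsU1 !inE (negPf yNB1) andbF (cardsD1 x B1) xB1.
apply: IH hy; apply: leq_trans (_ : #|B1 :\: B2| <= k)%N; last by [].
rewrite [X in (_ < X)%N](cardsD1 x) xB ltnS; apply/subset_leq_card/subsetP => z.
rewrite !inE; have [->|_] := eqVneq z y; first by rewrite yB2.
by move=> /= /and3P[-> -> ->].
Qed.

Lemma dual_exchange B1 B2 x : B1 \in bases M -> B2 \in bases M ->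
  x \in B2 :\: B1 -> exists2 y, y \in B1 :\: B2 & x |: (B1 :\ y) \in bases M.
Proof.
move=> hB1 hB2; rewrite inE => /andP[xNB1 xB2].
suff [B [hB xB sB BB]] : exists B,
    [/\ B \in bases M, x \in B, B1 :&: B2 \subset B & B :\: B1 = [set x]].
  have cB : #|B1 :\: B| = 1.
    have := card_bases hB1 hB; rewrite -(cardsID B B1) -(cardsID B1 B) BB.
    by rewrite setIC cards1 => /addnI.
  have /cards1P[y By] : #|B1 :\: B| == 1 by rewrite cB.
  have /andP[yNB yB1] : (y \notin B) && (y \in B1).
    by have := set11 y; rewrite -By inE.
  exists y.
    rewrite inE yB1 andbT; apply: contra yNB => yB2.
    by apply: (subsetP sB); rewrite inE yB1.
  suff -> : x |: B1 :\ y = B by [].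
  apply/setP => z; move/setP/(_ z): By; move/setP/(_ z): BB; rewrite !inE.
  by case: (z == x) (z == y) (z \in B) (z \in B1) => [] [] [] [].
suff H k B : (#|B :\: B1| < k)%N -> B \in bases M -> x \in B ->
    B1 :&: B2 \subset B -> exists B', [/\ B' \in bases M, x \in B',
      B1 :&: B2 \subset B' & B' :\: B1 = [set x]].
  by apply: (H #|B2 :\: B1|.+1 B2); rewrite ?subsetIr.
elim: k B => // k IH B lek hB xB sB.
case: (set_0Vmem (B :\: B1 :\ x)) => [BB|[z]].
  exists B; split=> //; apply/setP => z; move/setP/(_ z): BB; rewrite !inE.
  by have [->|_] := eqVneq z x; rewrite ?xNB1 ?xB.
rewrite !inE => /and3P[zx zNB1 zB].
have zD : z \in B :\: B1 by rewrite inE zNB1.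
have [y] := bases_exchange hB hB1 zD; rewrite inE => /andP[yNB yB1] hy.
apply: (IH (y |: B :\ z)) => //; last 2 first.
- by rewrite !inE [x == z]eq_sym zx xB orbT.
- apply/subsetP => t tB; have tB' := subsetP sB _ tB.
  move: tB; rewrite !inE tB' andbT => /andP[tB1 _].
  by have [tz|] := eqVneq t z; [rewrite -tz tB1 in zNB1|rewrite orbT].
- apply: leq_trans (_ : #|B :\: B1| <= k)%N; last by [].
  rewrite [X in (_ < X)%N](cardsD1 z) zD ltnS.
  apply/subset_leq_card/subsetP => t; rewrite !inE.
  by have [->|_] := eqVneq t y; [rewrite yB1|move=> /= /and3P[-> -> ->]].
Qed.

Definition dual_bases : {set {set E}} := [set ~: (B : {set E}) | B in bases M].

Lemma dual_bases_neq0 : dual_bases != set0.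
Proof.
have /set0Pn[B hB] := bases_neq0 M.
by apply/set0Pn; exists (~: B); apply: imset_f.
Qed.

Lemma dual_bases_exchange : basis_exchange dual_bases.
Proof.
move=> _ _ x /imsetP[B1 hB1 ->] /imsetP[B2 hB2 ->].
rewrite !inE negbK => /andP[xB2 xNB1].
have [|y] := @dual_exchange B1 B2 x hB1 hB2; first by rewrite inE xNB1.
rewrite inE => /andP[yNB2 yB1] hy.
exists y; first by rewrite !inE negbK yB1.
apply/imsetP; exists (x |: B1 :\ y) => //.
apply/setP => z; rewrite !inE negb_or negb_and negbK.
have [->|_ /=] := eqVneq z y; last by [].
by rewrite /= andbT; apply/esym; apply: contra xNB1 => /eqP <-.
Qed.

Definition dual_matroid : matroid E :=
  Matroid dual_bases_neq0 dual_bases_exchange.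

Variable e : E.

(* The new element is [None]; a basis may use [None] in place of [Some e]. *)
Definition parallel_bases : {set {set option E}} :=
  [set Some @: (B : {set E}) | B in bases M] :|:
  [set None |: Some @: (B :\ e) | B in [set B in bases M | e \in B]].

Lemma parallel_bases_neq0 : parallel_bases != set0.
Proof.
have /set0Pn[B hB] := bases_neq0 M.
by apply/set0Pn; exists (Some @: B); rewrite inE imset_f.
Qed.

Let f : option E -> E := odflt e.

Lemma parallel_basesP (A : {set option E}) :
  reflect (~~ ((None \in A) && (Some e \in A)) /\ f @: A \in bases M)
          (A \in parallel_bases).
Proof.
have Some_inj : injective (@Some E) by move=> ? ? [].
have NS B : None \in Some @: B = false by apply/negP => /imsetP[].
apply: (iffP idP) => [|[nA hA]].
  rewrite inE => /orP[] /imsetP[B hB ->].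
    rewrite NS; split=> //; rewrite -imset_comp.
    by rewrite (_ : _ @: B = B) //; apply/setP=> z; rewrite imset_id.
  move: hB; rewrite inE => /andP[hB eB].
  rewrite !inE mem_imset // !inE !eqxx /=; split=> //.
  rewrite imsetU1 -imset_comp imset_id /=.
  by rewrite setD1K.
rewrite inE; have [NA|NA] := boolP (None \in A); apply/orP; [right|left].
  move: nA; rewrite NA /= => eA.
  apply/imsetP; exists (f @: A).
    by rewrite inE hA; apply/imsetP; exists None.
  apply/setP => -[z|]; last by rewrite !inE NA.
  rewrite !inE mem_imset // !inE; have [->|ze] := eqVneq z e.
    by rewrite (negPf eA).
  apply/idP/imsetP => [zA|[[t|] tA zt]]; first by exists (Some z).
    by rewrite zt.
  by rewrite zt eqxx in ze.
apply/imsetP; exists (f @: A) => //.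
apply/setP => -[z|]; last by rewrite NS (negPf NA).
rewrite mem_imset //; apply/idP/imsetP => [zA|[[t|] tA zt]].
- by exists (Some z).
- by rewrite zt.
- by rewrite tA in NA.
Qed.

Lemma parallel_bases_exchange : basis_exchange parallel_bases.
Proof.
move=> A1 A2 x /parallel_basesP[n1 h1] /parallel_basesP[n2 h2].
rewrite inE => /andP[xNA2 xA1].
have f_inj : {in A1 &, injective f}.
  move=> [a|] [b|] //= aA bA ab; first by rewrite ab.
    by rewrite -ab in n1; rewrite aA bA in n1.
  by rewrite ab aA bA in n1.
have imD y : f @: (y |: A1 :\ x) = f y |: (f @: A1) :\ f x.
  rewrite imsetU1; congr (_ |: _); apply/setP => z; rewrite !inE.
  apply/imsetP/andP => [[t]|[zx /imsetP[t tA zt]]].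
    rewrite !inE => /andP[tx tA] ->; split; last exact: imset_f.
    by apply: contra tx => /eqP /f_inj ->.
  exists t; rewrite // !inE tA andbT; apply: contra zx => /eqP tx.
  by rewrite zt tx.
have [/imsetP[y yA2 xy]|fx] := boolP (f x \in f @: A2).
  have yx : y != x by apply: contra xNA2 => /eqP <-.
  have yA1 : y \notin A1 by apply: contra yx => yA1; rewrite (f_inj y x).
  exists y; first by rewrite inE yA1.
  apply/parallel_basesP; split; last first.
    by rewrite imD -xy setD1K // imset_f.
  case: x y {yA2 imD} xy yx yA1 xA1 {xNA2} => [a|] [b|] //= ab.
  - by rewrite ab eqxx.
  - by rewrite ab !inE !eqxx.
  - by rewrite !inE !eqxx.
have fxD : f x \in f @: A1 :\: f @: A2 by rewrite inE fx imset_f.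
have [z] := bases_exchange h1 h2 fxD; rewrite inE => /andP[zN /imsetP[y yA2 zy]] hz.
have yA1 : y \notin A1 by apply: contra zN => yA1; rewrite zy imset_f.
exists y; first by rewrite inE yA1.
apply/parallel_basesP; split; last by rewrite imD -zy.
case: y zy yA1 {yA2} => [b|] /= zy yA1; rewrite !inE /=.
  apply/negP => /andP[/andP[_ NA]] /orP[/eqP[eb]|/andP[_ eA]].
    by move/negP: zN; apply; apply/imsetP; exists None; rewrite // zy -eb.
  by rewrite NA eA in n1.
apply/negP => /andP[_ eA].
by move/negP: zN; apply; apply/imsetP; exists (Some e); rewrite // zy.
Qed.

Definition parallel_ext : matroid (option E) :=
  Matroid parallel_bases_neq0 parallel_bases_exchange.

End Exchange.

Definition series_ext (E : finType) (M : matroid E) (e : E) : matroid (option E) :=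
  dual_matroid (parallel_ext (dual_matroid M) e).

Section Uniform.
Variables (r n : nat) (le_rn : (r <= n)%N).

Definition uniform_bases : {set {set 'I_n}} :=
  [set B : {set 'I_n} | #|B| == r].

Lemma uniform_bases_neq0 : uniform_bases != set0.
Proof. by rewrite -card_gt0 card_draws card_ord bin_gt0. Qed.

Lemma uniform_bases_exchange : basis_exchange uniform_bases.
Proof.
move=> B1 B2 x; rewrite !inE => /eqP c1 /eqP c2 /andP[xN2 x1].
have /set0Pn[y yB] : B2 :\: B1 != set0.
  rewrite setD_eq0; apply: contra xN2 => s21.
  by have /eqP -> : B2 == B1 by rewrite eqEcard s21 c1 c2 leqnn.
exists y => //; move: yB; rewrite !inE => /andP[yN1 _].
by rewrite cardsU1 !inE (negPf yN1) andbF -c1 (cardsD1 x B1) x1.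
Qed.

Definition uniform_matroid : matroid 'I_n :=
  Matroid uniform_bases_neq0 uniform_bases_exchange.

End Uniform.

Inductive series_parallel : forall E : finType, matroid E -> Prop :=
| SP_uniform : series_parallel (@uniform_matroid 1 2 isT)
| SP_parallel (E : finType) (M : matroid E) (e : E) :
    series_parallel M -> ~~ is_loop M e -> series_parallel (parallel_ext M e)
| SP_series (E : finType) (M : matroid E) (e : E) :
    series_parallel M -> ~~ is_loop (dual_matroid M) e ->
    series_parallel (series_ext M e)
| SP_iso (E F : finType) (M : matroid E) (N : matroid F) :
    series_parallel M -> matroid_iso M N -> series_parallel N.

Section DirectSum.
Variables (I : finType) (E : I -> finType) (M : forall i, matroid (E i)).

Definition component (A : {set {i : I & E i}}) (i : I) : {set E i} :=
  [set x | Tagged E x \in A].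

Definition dsum_bases : {set {set {i : I & E i}}} :=
  [set A | [forall i, component A i \in bases (M i)]].

Lemma dsum_bases_neq0 : dsum_bases != set0.
Proof.
have hB i : exists B, B \in bases (M i) by apply/set0Pn/bases_neq0.
apply/set0Pn; exists [set u | tagged u \in xchoose (hB (tag u))].
rewrite inE; apply/forallP => i.
rewrite (_ : component _ i = xchoose (hB i)) ?(xchooseP (hB i)) //.
by apply/setP => x; rewrite !inE.
Qed.

Lemma dsum_bases_exchange : basis_exchange dsum_bases.
Proof.
move=> A1 A2 [i x]; rewrite !inE => /forallP h1 /forallP h2 /andP[xN2 x1].
have xD : x \in component A1 i :\: component A2 i by rewrite !inE xN2.
have [y] := bases_exchange (h1 i) (h2 i) xD.
rewrite !inE => yD hy; exists (Tagged E y); rewrite !inE //.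
apply/forallP => j; have [ij|ij] := eqVneq i j.
  case: j / ij; rewrite (_ : component _ i = y |: component A1 i :\ x) //.
  by apply/setP => z; rewrite !inE !eq_Tagged.
rewrite (_ : component _ j = component A1 j) //.
apply/setP => z; rewrite !inE.
have NE (t : E i) : (Tagged E z == Tagged E t) = false.
  by apply/eqP => /(congr1 tag) /= ji; rewrite ji eqxx in ij.
by rewrite !NE.
Qed.

Definition direct_sum : matroid {i : I & E i} :=
  Matroid dsum_bases_neq0 dsum_bases_exchange.

End DirectSum.

Definition sum_of_series_parallel (E : finType) (N : matroid E) : Prop :=
  exists (c : nat) (F : 'I_c -> finType) (M : forall i, matroid (F i)),
    [/\ (0 < c)%N, forall i, series_parallel (M i)
      & matroid_iso (direct_sum M) N].

From mathcomp Require Import boolp classical_sets functions cardinality.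
From mathcomp Require Import reals topology normedtype.

Import numFieldNormedType.Exports.

Local Open Scope classical_set_scope.
Local Open Scope ring_scope.

Section Hulls.
Variables (R : realType) (V : lmodType R).
Implicit Type A : set V.

Definition affine_hull A : set V :=
  [set x | exists (m : nat) (p : 'I_m -> V) (w : 'I_m -> R),
    [/\ forall i, A (p i), \sum_i w i = 1 & x = \sum_i w i *: p i]].

Definition convex_hull A : set V :=
  [set x | exists (m : nat) (p : 'I_m -> V) (w : 'I_m -> R),
    [/\ forall i, A (p i), forall i, 0 <= w i, \sum_i w i = 1
      & x = \sum_i w i *: p i]].

End Hulls.

Section Polytopes.
Variables (R : realType) (n : nat).
Local Notation V := 'rV[R]_n.
Implicit Types P F G : set V.

Definition is_polytope P : Prop :=
  exists2 A : set V, finite_set A & P = convex_hull A.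

(* [a] may be 0, so both P itself and the empty set are faces of P. *)
Definition is_face F P : Prop :=
  exists (a : V) (b : R),
    (forall x, P x -> \sum_i a 0 i * x 0 i <= b) /\
    F = P `&` [set x | \sum_i a 0 i * x 0 i = b].

(* The affine span of F is a translate of a k-dimensional linear subspace;    *)
(* in particular the empty set has no dimension.                              *)
Definition has_dim F (k : nat) : Prop :=
  exists (x0 : V) (U : {vspace V}),
    affine_hull F = [set x | x - x0 \in U] /\ \dim U = k.

Definition rel_interior P : set V :=
  [set x | P x /\ \forall y \near x, affine_hull P y -> P y].

Definition rel_boundary P : set V := closure P `\` rel_interior P.

(* The faces of the subdivision are the members of D, of all dimensions; the  *)
(* empty set is one of them.                                                  *)
Definition polyhedral_subdivision P (D : set (set V)) : Prop :=
  [/\ finite_set D,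
      forall F, D F -> is_polytope F,
      forall F G, D F -> is_face G F -> D G,
      forall F G, D F -> D G -> is_face (F `&` G) F /\ is_face (F `&` G) G
    & \bigcup_(F in D) F = P].

Definition interior_face P (D : set (set V)) F : Prop :=
  D F /\ ~ (F `<=` rel_boundary P).

Definition basis_vector (B : {set 'I_n}) : V := \sum_(i in B) delta_mx 0 i.

Definition matroid_polytope (M : matroid 'I_n) : set V :=
  convex_hull [set basis_vector B | B in [set` bases M]].

Definition corresponds_to F (N : matroid 'I_n) : Prop := F = matroid_polytope N.

End Polytopes.

Arguments matroid_polytope R {n} M.

(* Main.v *)
Require Import Defs.
From mathcomp Require Import all_boot all_order all_algebra ring lra.
From mathcomp Require Import boolp classical_sets functions cardinality.
From mathcomp Require Import reals topology normedtype.

Import Order.TTheory GRing.Theory Num.Theory numFieldNormedType.Exports.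

Set Implicit Arguments.
Unset Strict Implicit.
Unset Printing Implicit Defensive.

(** Two subdivisions are compared through an additive invariant of the polytope
    that is known on series-parallel polytopes.

    For a polytope P with vertices among the 0/1 vectors e_B, and variables
    t_1, ..., t_n, consider the lattice sums E_P(k) of the monomials t^x over
    the lattice points x in the relative interior of kP, for k >= 1.  The
    relative interior of Poly_M is the disjoint union of the relative interiors
    of the interior faces F of a subdivision, so E_{Poly_M}(k) is the sum of
    the E_F(k) ([cell_sum_subdivision]).  Hence any linear functional of the
    sequence E has the same total over the interior faces of two subdivisions,
    and it suffices to find functionals for which the contribution of F
    determines the dimension of F.

    By Brion's theorem E_P(k) is an exponential sum of terms c_B (t^B)^k, with
    t^B the product of the t_i for i in B, and c_B a rational function of t
    (the generating function of the tangent cone at e_B).  The functional used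
    here replaces (t^B)^k by
       w_B = prod_(i in B) (1 + u t_i) * prod_(i notin B) (1 + v / t_i).
    The result is Speyer's g-invariant, written as the equivariant localization
    that Fink and Speyer use in K-theory.  In place of tangent cones,
    [localizes_to] records an expression of a sequence as an exponential sum
    together with the resulting value, and such expressions follow the
    construction of a series-parallel matroid.  Parallel extension
    at e sums a geometric progression, which gives
       E'(k) = (t' E(k; t_e := t_e) - t_e E(k; t_e := t')) / (t_e - t')
    and changes the sign of the value ([localizes_to_parallel]); duality
    exchanges u, t_i with v, 1/t_i and keeps the value; a direct sum multiplies
    sequences and values.  A sum of c series-parallel matroids on n elements
    therefore has the value (-1)^n (uv - 1)^c
    ([sum_of_series_parallel_localizes]).  The value depends on the sequence
    alone, because exponentials with distinct nonzero ratios are linearly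
    independent ([localizes_to_unique]); t_i = 2^(2^i) makes all t^B distinct.

    With y = uv - 1, the sum of y^c(F) over the interior faces F is thus the
    same for both subdivisions and for every y, so they have equally many
    interior faces with c components ([count_from_power_sums]).  Such a face has
    dimension n - c: the linear forms that are constant on it are those constant
    on each component ([constant_on_components], [has_dim_from_constants]).

    The disjoint decomposition of the relative interior rests on convex
    geometry: a minimal cell through a point contains it in its relative
    interior, since otherwise a theorem of the alternative gives a smaller face
    through it ([farkas], [stiemke], [hull_interior_or_face]). *)

Local Open Scope ring_scope.

(** * Distributivity over a disjoint union of finite types *)

Section Distr.
Variables (R : comNzRingType) (I : finType) (E : I -> finType) (J : finType).

(** A function on the disjoint union is a family of functions on the summands;
    this is the expansion of a product of sums for dependent families. *)
Lemma sum_ffun_tagged (g : forall i, {ffun E i -> J} -> R) :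
  \sum_(x : {ffun {i : I & E i} -> J}) \prod_i g i [ffun y => x (Tagged E y)] =
  \prod_i \sum_(y : {ffun E i -> J}) g i y.
Proof.
pose P i : {ffun {ffun E i -> J} -> R} := [ffun y => g i y].
have -> : \prod_i \sum_(y : {ffun E i -> J}) g i y =
    \prod_i \sum_(y in tagged_with (fun i => {ffun E i -> J}) i) untag 0 (P i) y.
  apply: eq_bigr => i _; rewrite -(big_tag (fun i => P i)).
  by apply: eq_bigr => y _; rewrite ffunE.
rewrite bigA_distr_big_dep -big_fprod.
pose h (f : @fprod I (fun i => {ffun E i -> J})) : {ffun {i : I & E i} -> J} :=
  [ffun s => f (tag s) (tagged s)].
pose h' (x : {ffun {i : I & E i} -> J}) : @fprod I (fun i => {ffun E i -> J}) :=
  [fprod i => [ffun y => x (Tagged E y)]].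
rewrite (reindex h).
  apply: eq_bigr => f _; apply: eq_bigr => i _; rewrite ffunE; congr (g i _).
  by apply/ffunP => y; rewrite !ffunE.
apply: onW_bij; exists h' => [f|x].
  apply/fprodP => i; rewrite fprodE.
  by apply/ffunP => y; rewrite !ffunE.
by apply/ffunP => -[i y]; rewrite ffunE fprodE ffunE.
Qed.
End Distr.

(** * Lattice points in the interior of a dilated matroid polytope *)

Section Interior.
Variable R : realFieldType.

(** The relative interior of a polytope consists of the convex combinations of
    its vertices with all weights positive.  The weights have total s, so that
    x ranges over s times the interior of the polytope of M. *)
Definition in_dilated_interior (E : finType) (M : matroid E) (s : R)
    (x : E -> R) : Prop :=
  exists w : {set E} -> R,
    [/\ forall B, B \in bases M -> 0 < w B, \sum_(B in bases M) w B = s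
      & forall e, \sum_(B in bases M | e \in B) w B = x e].

Lemma in_dilated_interior_ext (E : finType) (M : matroid E) s (x y : E -> R) :
  x =1 y -> in_dilated_interior M s x -> in_dilated_interior M s y.
Proof. by move=> xy [w [? ? H]]; exists w; split=> // e; rewrite -xy. Qed.

Lemma in_dilated_interior_bounds (E : finType) (M : matroid E) s x :
  in_dilated_interior M s x -> 0 < s /\ forall e, 0 <= x e <= s.
Proof.
case=> w [w0 ws wx]; split.
  have /set0Pn[B hB] := bases_neq0 M.
  rewrite -ws (bigD1 B) //= ltr_pwDl ?w0 //.
  by apply: sumr_ge0 => C /andP[hC _]; exact/ltW/w0.
move=> e; rewrite -wx sumr_ge0 => [|B /andP[hB _]]; last exact/ltW/w0.
rewrite -ws [leRHS](bigID (fun B : {set E} => e \in B)) /= lerDl.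
by apply: sumr_ge0 => C /andP[hC _]; exact/ltW/w0.
Qed.

Lemma in_dilated_interior_iso (E F : finType) (M : matroid E) (N : matroid F)
    (f : E -> F) (s : R) (x : F -> R) :
  bijective f -> bases N = [set f @: (B : {set E}) | B in bases M] ->
  in_dilated_interior N s x <-> in_dilated_interior M s (x \o f).
Proof.
move=> bf bN; have injf := bij_inj bf; have injF := imset_inj injf.
have sumN (P : pred {set F}) (g : {set F} -> R) :
    \sum_(B in bases N | P B) g B = \sum_(B in bases M | P (f @: B)) g (f @: B).
  rewrite bN big_mkcondr big_imset /=; last by move=> A B _ _; exact: injF.
  by rewrite -big_mkcondr.
have sumN' (g : {set F} -> R) : \sum_(B in bases N) g B = \sum_(B in bases M) g (f @: B).
  rewrite (eq_bigl _ _ (fun B => esym (andbT _))) (sumN xpredT).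
  by apply: eq_bigl => B; rewrite andbT.
case: (bf) => f' fK f'K.
split=> -[w [w0 ws wx]].
  exists (fun B : {set E} => w (f @: B)); split.
  - by move=> B hB; apply: w0; rewrite bN imset_f.
  - by rewrite -sumN'.
  - move=> e /=; rewrite -wx sumN; apply: eq_bigl => B.
    by rewrite mem_imset.
exists (fun B : {set F} => w (f' @: B)).
have KB (B : {set E}) : f' @: (f @: B) = B.
  by rewrite -imset_comp (eq_imset _ fK) imset_id.
split.
- by move=> _ /[!bN] /imsetP[B hB ->]; rewrite KB w0.
- by rewrite sumN' -ws; apply: eq_bigr => B _; rewrite KB.
- move=> e; rewrite sumN -(f'K e) -[RHS]wx.
  by apply: eq_big => [B|B _]; rewrite ?mem_imset ?KB.
Qed.

Lemma in_dilated_interior_dual (E : finType) (M : matroid E) (s : R) x :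
  in_dilated_interior (dual_matroid M) s x <->
  in_dilated_interior M s (fun e => s - x e).
Proof.
have injC : injective (@finset.setC E) by exact: can_inj (@finset.setCK E).
have sumC (P : pred {set E}) (g : {set E} -> R) :
    \sum_(B in bases (dual_matroid M) | P B) g B =
    \sum_(B in bases M | P (~: B)) g (~: B).
  rewrite big_mkcondr big_imset /=; last exact: in2W injC.
  by rewrite -big_mkcondr.
have sumC' (g : {set E} -> R) : \sum_(B in bases (dual_matroid M)) g B =
    \sum_(B in bases M) g (~: B).
  rewrite (eq_bigl _ _ (fun B => esym (andbT _))) (sumC xpredT).
  by apply: eq_bigl => B; rewrite andbT.
split=> -[w [w0 ws wx]]; exists (fun B => w (~: B)).
- have ws' : \sum_(B in bases M) w (~: B) = s by rewrite -sumC'.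
  split=> // [B hB|e]; first by apply: w0; rewrite imset_f.
  have -> : s = \sum_(B in bases M | e \in B) w (~: B) + x e.
    rewrite -ws' -wx sumC (bigID (fun B : {set E} => e \in B)) /=.
    by congr (_ + _); apply: eq_bigl => B; rewrite finset.in_setC.
  by rewrite addrK.
- split=> [_ /imsetP[B hB ->]||e]; first by rewrite finset.setCK w0.
    by rewrite sumC' -ws; apply: eq_bigr => B _; rewrite finset.setCK.
  have -> : x e = s - (s - x e) by rewrite subKr.
  rewrite sumC -wx -ws [X in _ = X - _](bigID (fun B : {set E} => e \in B)) /=.
  rewrite addrAC subrr add0r.
  by apply: eq_big => [B|B _]; rewrite ?finset.in_setC ?finset.setCK.
Qed.

Lemma sum_parallel_bases (E : finType) (M : matroid E) (e : E)
    (P : pred {set option E}) (g : {set option E} -> R) :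
  \sum_(A in bases (parallel_ext M e) | P A) g A =
  \sum_(B in bases M | P (Some @: B)) g (Some @: B) +
  \sum_(B in bases M | (e \in B) && P (None |: Some @: (B :\ e)))
    g (None |: Some @: (B :\ e)).
Proof.
have Some_inj : injective (@Some E) by move=> ? ? [].
have NS (B : {set E}) : None \in Some @: B = false by apply/negP => /imsetP[].
rewrite big_mkcondr /= /parallel_bases.
set A1 := [set Some @: (B : {set E}) | B in bases M].
set A2 := [set _ | B in _ ].
rewrite (eq_bigl (fun A => A \in [predU A1 & A2])) => [|A]; last first.
  by rewrite finset.in_setU inE.
rewrite bigU /=; last first.
  apply/pred0P => A /=; apply/negP => /andP[/imsetP[B _ ->] /imsetP[C _]].
  by move/finset.setP/(_ None); rewrite NS !inE eqxx.
rewrite /A1 /A2 big_imset /=; last by move=> A B _ _; exact: imset_inj.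
rewrite -big_mkcondr; congr (_ + _).
rewrite big_imset /=; last first.
  move=> A B; rewrite !inE => /andP[_ eA] /andP[_ eB] /finset.setP AB.
  apply/finset.setP => z; have := AB (Some z); rewrite !inE /= !mem_imset // !inE.
  by have [->|_ //] := eqVneq z e; rewrite eA eB.
rewrite -big_mkcondr; apply: eq_bigl => B; rewrite inE andbA.
by [].
Qed.

(** In a parallel extension the weight of a basis containing e may be split
    arbitrarily between e and its copy; positive weights induce positive
    coordinates at both because e lies in some basis.  Conversely, splitting
    every such basis in the ratio x_e : x_e' realizes any two positive
    coordinates with the right sum. *)
Lemma in_dilated_interior_parallel (E : finType) (M : matroid E) (e : E)
    (s : R) (x : option E -> R) : ~~ is_loop M e ->
  in_dilated_interior (parallel_ext M e) s x <->
  [/\ 0 < x None, 0 < x (Some e)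
    & in_dilated_interior M s (fun i => x (Some i) + x None *+ (i == e))].
Proof.
move=> /forallPn[B0]; rewrite negb_imply negbK => /andP[hB0 eB0].
have Some_inj : injective (@Some E) by move=> ? ? [].
have NS (B : {set E}) : None \in Some @: B = false by apply/negP => /imsetP[].
have SS i (B : {set E}) : (Some i \in Some @: B) = (i \in B) by rewrite mem_imset.
have SN i (B : {set E}) : (Some i \in None |: Some @: (B :\ e)) = (i != e) && (i \in B).
  by rewrite finset.in_setU1 /= SS !inE.
have sum' (g : {set option E} -> R) : \sum_(A in bases (parallel_ext M e)) g A =
    \sum_(B in bases M) g (Some @: B) +
    \sum_(B in bases M | e \in B) g (None |: Some @: (B :\ e)).
  rewrite (eq_bigl _ _ (fun B => esym (andbT _))) (sum_parallel_bases M e xpredT).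
  by congr (_ + _); apply: eq_bigl => B; rewrite andbT.
have eposs (g : {set E} -> R) : (forall B, B \in bases M -> 0 < g B) ->
    0 < \sum_(B in bases M | e \in B) g B.
  move=> g0; rewrite (bigD1 B0) /=; last by rewrite hB0.
  by rewrite ltr_pwDl ?g0 // sumr_ge0 // => B /andP[/andP[/g0/ltW]].
have inS B : B \in bases M -> Some @: B \in bases (parallel_ext M e).
  by move=> hB; rewrite inE imset_f.
have inN B : B \in bases M -> e \in B ->
    None |: Some @: (B :\ e) \in bases (parallel_ext M e).
  move=> hB eB; rewrite inE; apply/orP; right; apply/imsetP; exists B => //.
  by rewrite inE hB.
split=> [[w [w0 ws wx]]|[xN xe [w [w0 ws wx]]]].
- have xNE : x None = \sum_(B in bases M | e \in B) w (None |: Some @: (B :\ e)).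
    rewrite -wx sum_parallel_bases big1 ?add0r; last first.
      by move=> B; rewrite NS andbF.
    by apply: eq_bigl => B; rewrite !inE eqxx /= andbT.
  have xeE i : x (Some i) = \sum_(B in bases M | i \in B) w (Some @: B) +
      \sum_(B in bases M | [&& e \in B, i != e & i \in B])
         w (None |: Some @: (B :\ e)).
    rewrite -wx sum_parallel_bases; congr (_ + _); apply: eq_bigl => B.
      by rewrite SS.
    by rewrite SN.
  split.
  + rewrite xNE (bigD1 B0) ?hB0 //= ltr_pwDl ?w0 ?inN //.
    by apply: sumr_ge0 => B /andP[/andP[hB eB] _]; exact/ltW/w0/inN.
  + rewrite xeE [X in _ + X]big1 ?addr0; last first.
      by move=> B; rewrite eqxx andbF andbF.
    by rewrite eposs // => B hB; exact/w0/inS.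
  + exists (fun B : {set E} => w (Some @: B) +
             (w (None |: Some @: (B :\ e))) *+ (e \in B)); split.
    * move=> B hB; have [eB|_] := boolP (e \in B); last by rewrite addr0 w0 ?inS.
      by rewrite addr_gt0 ?w0 ?inS ?inN.
    * rewrite big_split -ws sum' /=; congr (_ + _).
      rewrite [RHS]big_mkcondr /=; apply: eq_bigr => B _.
      by case: (e \in B).
    * move=> i; rewrite big_split /= xeE -addrA; congr (_ + _).
      have [->|ie] := eqVneq i e.
        rewrite [X in _ = X + _]big1 ?add0r; last first.
          by move=> B; rewrite andbF andbF.
        by rewrite xNE; apply: eq_bigr => B /andP[_ ->].
      rewrite addr0 [LHS]big_mkcondr [RHS]big_mkcondr.
      by apply: eq_bigr => B _; case: (e \in B); case: (i \in B).
pose a := x None; pose b := x (Some e).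
have ab : 0 < a + b by rewrite addr_gt0.
have abE : \sum_(B in bases M | e \in B) w B = a + b.
  by rewrite wx eqxx addrC.
(* Bases containing e or its copy share the weight of their image in M in the
   ratio x_e : x_e'. *)
pose w' (A : {set option E}) :=
  let B := odflt e @: A in
  if None \in A then w B * (a / (a + b))
  else if Some e \in A then w B * (b / (a + b)) else w B.
have fS (B : {set E}) : odflt e @: (Some @: B) = B.
  by rewrite -imset_comp imset_id.
have fN (B : {set E}) : e \in B -> odflt e @: (None |: Some @: (B :\ e)) = B.
  by move=> eB; rewrite imsetU1 -imset_comp imset_id /= finset.setD1K.
have w'S (B : {set E}) : w' (Some @: B) =
    if e \in B then w B * (b / (a + b)) else w B.
  by rewrite /w' NS SS fS.
have w'N (B : {set E}) : e \in B ->
    w' (None |: Some @: (B :\ e)) = w B * (a / (a + b)).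
  by move=> eB; rewrite /w' finset.in_setU1 eqxx /= fN.
have split_w (B : {set E}) : e \in B -> w B = w' (Some @: B) + w' (None |: Some @: (B :\ e)).
  move=> eB; rewrite w'S eB w'N // -mulrDr -mulrDl [b + a]addrC divff ?mulr1 //.
  by rewrite gt_eqF.
have sum_w (P : pred {set E}) : \sum_(B in bases M | P B) w B =
   \sum_(B in bases M | P B) w' (Some @: B) +
   \sum_(B in bases M | (e \in B) && P B) w' (None |: Some @: (B :\ e)).
  rewrite [X in _ = _ + X](eq_bigl (fun B => (B \in bases M) && P B && (e \in B))); last first.
    by move=> B; rewrite -andbA; congr (_ && _); rewrite andbC.
  rewrite [X in _ = _ + X]big_mkcondr -big_split /=.
  apply: eq_bigr => B _; case: ifP => [eB|eB]; first exact: split_w.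
  by rewrite w'S eB addr0.
exists w'; split.
- move=> A; rewrite inE => /orP[] /imsetP[B].
    move=> hB ->; rewrite w'S; case: ifP => _; last exact: w0.
    by rewrite mulr_gt0 ?w0 // divr_gt0.
  rewrite inE => /andP[hB eB] ->; rewrite w'N //.
  by rewrite mulr_gt0 ?w0 // divr_gt0.
- rewrite sum' -ws [RHS](eq_bigl _ _ (fun B => esym (andbT _))) (sum_w xpredT).
  by congr (_ + _); apply: eq_bigl => B; rewrite andbT.
- case=> [i|]; rewrite sum_parallel_bases; last first.
    rewrite big1 ?add0r => [|B]; last by rewrite NS andbF.
    rewrite (eq_bigl (fun B => (B \in bases M) && (e \in B))); last first.
      by move=> B; rewrite finset.in_setU1 eqxx /= andbT.
    rewrite (eq_bigr (fun B => w B * (a / (a + b)))); last first.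
      by move=> B /andP[_ eB]; rewrite w'N.
    by rewrite -mulr_suml abE mulrC divfK // gt_eqF.
  rewrite (eq_bigl (fun B => (B \in bases M) && (i \in B))); last first.
    by move=> B; rewrite SS.
  have [->|ie] := eqVneq i e.
    rewrite [X in _ + X]big1 ?addr0; last first.
      by move=> B; rewrite SN eqxx !andbF.
    rewrite (eq_bigr (fun B => w B * (b / (a + b)))); last first.
      by move=> B /andP[_ eB]; rewrite w'S eB.
    by rewrite -mulr_suml abE mulrC divfK // gt_eqF.
  have := wx i; rewrite (negPf ie) addr0 => <-.
  rewrite sum_w; congr (_ + _); apply: eq_bigl => B.
  by rewrite SN ie.
Qed.
End Interior.

Section DirectSum.
Variables (R : realFieldType) (I : finType) (E : I -> finType).
Variable (M : forall i, matroid (E i)).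

(** Bases of the summands can be chosen independently. *)
Lemma direct_sum_replace_component A0 i B :
  A0 \in bases (direct_sum M) -> B \in bases (M i) ->
  exists A, [/\ A \in bases (direct_sum M), component A i = B &
    forall j, j != i -> component A j = component A0 j].
Proof.
rewrite inE => /forallP hA0 hB.
pose A := [set u in A0 | tag u != i] :|: [set Tagged E b | b in B].
have Ai : component A i = B.
  apply/finset.setP => z; rewrite !inE /= eqxx andbF /=.
  rewrite mem_imset // => a b /eqP; rewrite eq_Tagged => /eqP; exact.
have Aj j : j != i -> component A j = component A0 j.
  move=> ij; apply/finset.setP => z; rewrite !inE /= ij andbT.
  suff -> : (Tagged E z \in [set Tagged E b | b in B]) = false by rewrite orbF.
  by apply/negP => /imsetP[b _ /(congr1 tag)/= ji]; rewrite ji eqxx in ij.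
exists A; split=> //; rewrite inE; apply/forallP => j.
by have [->|ij] := eqVneq j i; [rewrite Ai|rewrite Aj].
Qed.


Lemma sum_set_component (g : forall i, {set E i} -> R) :
  \sum_(A : {set {i : I & E i}}) \prod_i g i (component A i) =
  \prod_i \sum_(B : {set E i}) g i B.
Proof.
have bij (T : finType) : bijective (fun f : {ffun T -> bool} => finset f).
  by exists (fun A : {set T} => [ffun x => x \in A]) => [f|A];
    [apply/ffunP => x; rewrite ffunE inE | apply/finset.setP => x; rewrite inE ffunE].
transitivity (\prod_i \sum_(y : {ffun E i -> bool}) g i (finset y)); last first.
  by apply: eq_bigr => i _; rewrite (reindex _ (onW_bij _ (bij _))).
rewrite -sum_ffun_tagged (reindex _ (onW_bij _ (bij _))).
apply: eq_bigr => f _; apply: eq_bigr => i _; congr (g i _).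
by apply/finset.setP => x; rewrite !inE ffunE.
Qed.

Lemma prod_if (P : pred I) (F : I -> R) :
  \prod_i (if P i then F i else 0) = if [forall i, P i] then \prod_i F i else 0.
Proof.
case: ifPn => [/forallP H|/forallPn[i Pi]].
  by apply: eq_bigr => i _; rewrite H.
by rewrite (bigD1 i) //= (negPf Pi) mul0r.
Qed.

(** The interior of a product is the product of the interiors: in one direction
    the weights are marginals, in the other they are products. *)
Lemma in_dilated_interior_direct_sum (s : R) x : 0 < s ->
  in_dilated_interior (direct_sum M) s x <->
  forall i, in_dilated_interior (M i) s (fun e => x (Tagged E e)).
Proof.
move=> s0; split=> [[w [w0 ws wx]] i|H].
  exists (fun B => \sum_(A in bases (direct_sum M) | component A i == B) w A).
  split=> [B hB|| e].
  - have /set0Pn[A0 hA0] := dsum_bases_neq0 M.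
    have [A [hA Ai _]] := direct_sum_replace_component hA0 hB.
    rewrite (bigD1 A) /=; last by rewrite hA Ai eqxx.
    by rewrite ltr_pwDl ?w0 // sumr_ge0 // => C /andP[/andP[/w0/ltW]].
  - rewrite -ws (partition_big (fun A => component A i) (mem (bases (M i)))) //=.
    by move=> A; rewrite inE => /forallP/(_ i).
  - rewrite -wx [RHS](partition_big (fun A => component A i)
      (fun B => (B \in bases (M i)) && (e \in B))) /=; last first.
      by move=> A /andP[]; rewrite inE => /forallP/(_ i) -> /=; rewrite inE.
    apply: eq_bigr => B /andP[_ eB]; apply: eq_bigl => A; rewrite -andbA.
    congr (_ && _); have [AB|_] := eqVneq; last by rewrite andbF.
    by rewrite andbT; move: eB; rewrite -AB inE => ->.
pose w i := sval (cid (H i)).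
have w0 i B : B \in bases (M i) -> 0 < w i B.
  by rewrite /w; case: (cid _) => ? /= [h _ _]; exact: h.
have ws i : \sum_(B in bases (M i)) w i B = s.
  by rewrite /w; case: (cid _) => ? /= [_ h _].
have wx i e : \sum_(B in bases (M i) | e \in B) w i B = x (Tagged E e).
  by rewrite /w; case: (cid _) => ? /= [_ _ h]; exact: h.
have sn0 : s != 0 by rewrite gt_eqF.
have main (Q : forall i, pred {set E i}) :
    \sum_(A in bases (direct_sum M) | [forall i, Q i (component A i)])
      s * \prod_i (w i (component A i) / s) =
    s * \prod_i ((\sum_(B in bases (M i) | Q i B) w i B) / s).
  rewrite -mulr_sumr; congr (_ * _).
  transitivity (\prod_i \sum_(B : {set E i})
     (if (B \in bases (M i)) && Q i B then w i B / s else 0)); last first.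
    apply: eq_bigr => i _; rewrite mulr_suml [RHS]big_mkcond.
    by apply: eq_bigr => B _.
  rewrite -sum_set_component big_mkcond; apply: eq_bigr => A _.
  rewrite prod_if; congr (if _ then _ else _); rewrite inE.
  apply/andP/forallP => [[/forallP h1 /forallP h2] i|h]; first by rewrite h1 h2.
  by split; apply/forallP => i; have /andP[] := h i.
exists (fun A => s * \prod_i (w i (component A i) / s)); split.
- move=> A; rewrite inE => /forallP hA; rewrite mulr_gt0 //.
  by apply: prodr_gt0 => i _; rewrite divr_gt0 ?w0 ?hA.
- transitivity (s * \prod_i ((\sum_(B in bases (M i) | predT B) w i B) / s)).
    rewrite -(main (fun _ => predT)); apply: eq_bigl => A.
    by rewrite -[LHS]andbT; congr (_ && _); apply/esym/forallP.
  rewrite big1 ?mulr1 // => i _.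
  by rewrite (eq_bigl (mem (bases (M i)))) => [|B]; rewrite ?ws ?divff ?andbT.
- case=> i e.
  (* The condition that A contains e, as a conjunction over the components. *)
  pose Q j (B : {set E j}) := [forall y, (Tagged E y == Tagged E e) ==> (y \in B)].
  transitivity (s * \prod_j ((\sum_(B in bases (M j) | Q j B) w j B) / s)).
    rewrite -main; apply: eq_bigl => A; congr (_ && _).
    apply/idP/forallP => [eA j|/(_ i)/forallP/(_ e)]; last by rewrite eqxx inE.
    by apply/forallP => y; apply/implyP; rewrite inE => /eqP ->.
  rewrite (bigD1 i) //= [X in _ * (_ * X)]big1 ?mulr1 => [|j ji].
    rewrite mulrC divfK // -wx; apply: eq_bigl => B; congr (_ && _).
    apply/forallP/idP => [/(_ e)|eB y]; first by rewrite eqxx.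
    by apply/implyP; rewrite eq_Tagged => /eqP /= ->.
  rewrite (eq_bigl (mem (bases (M j)))) => [|B]; rewrite ?ws ?divff //.
  rewrite (_ : Q j B) ?andbT //; apply/forallP => y; apply/implyP => /eqP.
  by move/(congr1 tag) => /= E'; rewrite E' eqxx in ji.
Qed.
End DirectSum.

(** * Lattice sums and the matroid operations *)

Section LatticeSum.
Variable R : realFieldType.

(** The coordinates of a point of k times the polytope lie between 0 and k,
    which makes the sum over lattice points finite. *)
Definition lattice_sum (E : finType) (M : matroid E) (t : E -> R) (k : nat) : R :=
  \sum_(x : {ffun E -> 'I_k.+1} |
          `[< in_dilated_interior M (k%:R : R) (fun e => (x e)%:R) >])
    \prod_e t e ^+ x e.

Lemma lattice_sum_iso (E F : finType) (M : matroid E) (N : matroid F)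
    (f : E -> F) t k :
  bijective f -> bases N = [set f @: (B : {set E}) | B in bases M] ->
  lattice_sum N t k = lattice_sum M (t \o f) k.
Proof.
move=> bf bN; case: (bf) => f' fK f'K; rewrite /lattice_sum.
rewrite (reindex (fun y : {ffun E -> 'I_k.+1} => [ffun e => y (f' e)])) /=.
  apply: eq_big => [y|y _].
    apply/asboolP/asboolP.
      move=> /(in_dilated_interior_iso _ _ bf bN).
      by apply: in_dilated_interior_ext => e /=; rewrite ffunE fK.
    move=> H; apply/(in_dilated_interior_iso _ _ bf bN).
    by apply: in_dilated_interior_ext H => e /=; rewrite ffunE fK.
  rewrite (reindex f) /=; last exact: onW_bij.
  by apply: eq_bigr => e _; rewrite ffunE fK.
apply: onW_bij; exists (fun x : {ffun F -> 'I_k.+1} => [ffun e => x (f e)]) => x;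
  by apply/ffunP => e; rewrite !ffunE ?fK ?f'K.
Qed.

(** Complementation of bases is the reflection x |-> k - x. *)
Lemma lattice_sum_dual (E : finType) (M : matroid E) (t : E -> R) k :
  (forall e, t e != 0) ->
  lattice_sum (dual_matroid M) t k =
  (\prod_e t e) ^+ k * lattice_sum M (fun e => (t e)^-1) k.
Proof.
move=> t0; rewrite /lattice_sum mulr_sumr.
pose h (x : {ffun E -> 'I_k.+1}) : {ffun E -> 'I_k.+1} := [ffun e => rev_ord (x e)].
have revE (i : 'I_k.+1) : rev_ord i = (k - i)%N :> nat by rewrite /= subSS.
have lek (i : 'I_k.+1) : (i <= k)%N by rewrite -ltnS.
rewrite (reindex h); last first.
  by apply: onW_bij; exists h => x; apply/ffunP => e; rewrite !ffunE rev_ordK.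
apply: eq_big => [x|x _].
  apply/asboolP/asboolP.
    move=> /in_dilated_interior_dual; apply: in_dilated_interior_ext => e.
    by rewrite ffunE revE natrB // subKr.
  move=> H; apply/in_dilated_interior_dual; apply: in_dilated_interior_ext H => e.
  by rewrite ffunE revE natrB // subKr.
rewrite -prodrXl -big_split /=; apply: eq_bigr => e _.
by rewrite ffunE revE exprVn expfB_cond // (negPf (t0 e)) add0n.
Qed.

Lemma lattice_sum_direct_sum (I : finType) (E : I -> finType)
    (M : forall i, matroid (E i)) t k : (0 < k)%N ->
  lattice_sum (direct_sum M) t k =
  \prod_i lattice_sum (M i) (fun e => t (Tagged E e)) k.
Proof.
move=> k0; have k0' : 0 < k%:R :> R by rewrite ltr0n.
pose g i (y : {ffun E i -> 'I_k.+1}) : R :=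
  if `[< in_dilated_interior (M i) (k%:R : R) (fun e => (y e)%:R) >]
  then \prod_e t (Tagged E e) ^+ y e else 0.
transitivity (\prod_i \sum_y g i y); last first.
  by apply: eq_bigr => i _; rewrite /lattice_sum [RHS]big_mkcond.
rewrite -sum_ffun_tagged /lattice_sum [LHS]big_mkcond; apply: eq_bigr => x _.
rewrite prod_if; congr (if _ then _ else _).
  apply/asboolP/forallP => [/(in_dilated_interior_direct_sum _ _ k0') H i|H].
    apply/asboolP; apply: in_dilated_interior_ext (H i) => e.
    by rewrite ffunE.
  apply/(in_dilated_interior_direct_sum _ _ k0') => i.
  have /asboolP := H i.
  by apply: in_dilated_interior_ext => e; rewrite ffunE.
by rewrite sig_big_dep /=; apply: eq_bigr => -[i e] _; rewrite ffunE.
Qed.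

(** The interior lattice points that split s into two positive parts; the
    truncation at both ends produces the factors b and a on the right. *)
Lemma geometric_sum (a b : R) (k s : nat) : (0 < s <= k.+1)%N ->
  (a - b) * \sum_(j < k.+1 | (0 < j < s)%N) b ^+ j * a ^+ (s - j) =
  b * a ^+ s - a * b ^+ s.
Proof.
case: s => // s /= sk.
transitivity ((a - b) * \sum_(j < s) a ^+ (s.-1 - j) * b ^+ j * (a * b)).
  congr (_ * _).
  rewrite -(big_mkord (fun j => 0 < j < s.+1)%N (fun j => b ^+ j * a ^+ (s.+1 - j))).
  rewrite -(big_mkord xpredT (fun j => a ^+ (s.-1 - j) * b ^+ j * (a * b))).
  rewrite big_mkcond big_ltn //= add0r -big_mkcond big_add1 /=.
  rewrite (eq_bigl (fun j => xpredT j && (j < s)%N)) => [|j]; last by rewrite ltnS.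
  rewrite -big_nat_widen // big_nat_cond [RHS]big_nat_cond.
  apply: eq_bigr => j /andP[/andP[_ js] _].
  rewrite subSS (_ : (s - j = (s.-1 - j).+1)%N) ?exprS; first by ring.
  by case: s js {sk} => // s js; rewrite subSn.
rewrite -mulr_suml mulrA -subrXX !exprS; ring.
Qed.

(** Lattice points of the extension are pairs of a lattice point x for M and a
    splitting of x_e into two positive parts; summing over the splittings gives
    a difference of two lattice sums of M, in which e carries the variable of e
    or that of its copy. *)
Lemma lattice_sum_parallel (E : finType) (M : matroid E) (e : E)
    (t : option E -> R) k : ~~ is_loop M e ->
  (t (Some e) - t None) * lattice_sum (parallel_ext M e) t k =
  t None * lattice_sum M (t \o Some) k -
  t (Some e) * lattice_sum M (fun i => t (if i == e then None else Some i)) k.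
Proof.
move=> loopNe; rewrite /lattice_sum.
(* [h] splits off the part p.2 from the coordinate of e, and [h'] merges. *)
pose h (p : {ffun E -> 'I_k.+1} * 'I_k.+1) : {ffun option E -> 'I_k.+1} :=
  [ffun o => if o is Some i then if i == e then inord (p.1 i - p.2) else p.1 i
             else p.2].
pose h' (x : {ffun option E -> 'I_k.+1}) : {ffun E -> 'I_k.+1} * 'I_k.+1 :=
  ([ffun i => if i == e then inord (x (Some i) + x None) else x (Some i)], x None).
have lek (i : 'I_k.+1) : (i <= k)%N by rewrite -ltnS.
have posE (x : {ffun option E -> 'I_k.+1}) :
    in_dilated_interior (parallel_ext M e) (k%:R : R) (fun o => (x o)%:R) ->
    (x (Some e) + x None <= k)%N.
  move=> /(in_dilated_interior_parallel _ _ loopNe)[_ _ /in_dilated_interior_bounds[_]].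
  by move=> /(_ e)/andP[_]; rewrite eqxx -natrD ler_nat.
rewrite (reindex_onto h h') /=; last first.
  move=> x /asboolP/posE le_k; apply/ffunP => -[i|]; rewrite !ffunE //=.
  case: eqVneq => // ->; apply/val_inj => /=.
  by rewrite !inordK ?addnK.
rewrite (eq_bigl (fun p : {ffun E -> 'I_k.+1} * 'I_k.+1 =>
   `[< in_dilated_interior M (k%:R : R) (fun i => (p.1 i)%:R) >] && (0 < p.2 < p.1 e)%N));
   last first.
  move=> [x a] /=; apply/andP/andP => [[/asboolP Hpos /eqP hh]|[/asboolP Hpos /andP[a0 ax]]].
    have xe : x e = (x e - a + a)%N :> nat.
      move: (posE _ Hpos) hh; rewrite !ffunE eqxx /= inordK; last first.
        by rewrite ltnS (leq_trans (leq_subr _ _)).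
      move=> le_k [/ffunP/(_ e)]; rewrite !ffunE eqxx => /(congr1 val) /=.
      by rewrite inordK ?ffunE ?eqxx ?inordK // ltnS (leq_trans (leq_subr _ _)).
    have [] := (in_dilated_interior_parallel _ _ loopNe).1 Hpos.
    rewrite !ffunE eqxx /= inordK; last by rewrite ltnS (leq_trans (leq_subr _ _)).
    rewrite !ltr0n => a0 xa H; rewrite a0 -subn_gt0 xa; split=> //; apply/asboolP.
    apply: in_dilated_interior_ext H => i; rewrite !ffunE; case: eqVneq => [->|ie] /=.
      rewrite inordK; last by rewrite ltnS (leq_trans (leq_subr _ _)).
      by rewrite -natrD -xe.
    by rewrite mulr0n addr0.
  have ltk : (x e - a < k.+1)%N by rewrite ltnS (leq_trans (leq_subr _ _)).
  split; last first.
    apply/eqP; congr (_, _); last by rewrite ffunE.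
    apply/ffunP => i; rewrite !ffunE; case: eqVneq => // ->; apply/val_inj.
    by rewrite /= !inordK ?subnK // ltnW.
  apply/asboolP/(in_dilated_interior_parallel _ _ loopNe).
  rewrite !ffunE eqxx /= inordK // !ltr0n subn_gt0; split=> //.
  apply: in_dilated_interior_ext Hpos => i; rewrite !ffunE; case: eqVneq => [->|_].
    by rewrite inordK // -natrD subnK // ltnW.
  by rewrite addr0.
rewrite -(pair_big_dep
  (fun x : {ffun E -> 'I_k.+1} =>
     `[< in_dilated_interior M (k%:R : R) (fun i => (x i)%:R) >])
  (fun (x : {ffun E -> 'I_k.+1}) (a : 'I_k.+1) => (0 < a < x e)%N)
  (fun x a => \prod_o t o ^+ h (x, a) o)) /=.
rewrite !mulr_sumr -sumrB; apply: eq_bigr => x /asboolP[w [w0 _ wx]].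
have xe0 : (0 < x e)%N.
  rewrite -(ltr0n R) -wx; have /forallPn[B] := loopNe.
  rewrite negb_imply negbK => hB; rewrite (bigD1 B) //= ltr_pwDl ?w0 //.
    by case/andP: hB.
  by apply: sumr_ge0 => C /andP[/andP[hC _] _]; exact/ltW/w0.
have prod_option (F : option E -> R) : \prod_o F o = F None * \prod_i F (Some i).
  rewrite (bigD1 None) //=; congr (_ * _).
  rewrite (reindex_omap Some id) //=; last by case.
  by apply: eq_bigl => i; rewrite eqxx.
rewrite (eq_bigr (fun a : 'I_k.+1 => (t None ^+ a * t (Some e) ^+ (x e - a)) *
    \prod_(i | i != e) t (Some i) ^+ x i)); last first.
  move=> a /andP[a0 ax]; rewrite prod_option !ffunE /= -mulrA; congr (_ * _).
  rewrite (bigD1 e) //= !ffunE eqxx inordK; last first.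
    by rewrite ltnS (leq_trans (leq_subr _ _)).
  by congr (_ * _); apply: eq_bigr => i ie; rewrite !ffunE (negPf ie).
rewrite -mulr_suml mulrA geometric_sum; last by rewrite xe0 (leq_trans (lek _)).
rewrite mulrBl; congr (_ - _); rewrite -mulrA; congr (_ * _).
  by rewrite [RHS](bigD1 e).
rewrite [RHS](bigD1 e) //= eqxx; congr (_ * _).
by apply: eq_bigr => i ie; rewrite (negPf ie).
Qed.
End LatticeSum.

(** * Exponential sums and their localized value *)

Section Localization.
Variable R : realFieldType.
Implicit Types u v V W : R.

(** The factor by which localization replaces the exponential of A, relative to
    the ground set X.  The exponents of t are opposite to those of the closed
    polytope because the sums range over its relative interior. *)
Definition vertex_weight (E : finType) u v (t : E -> R) (X A : {set E}) : R :=
  \prod_(i in A) (1 + u * t i) * \prod_(i in X :\: A) (1 + v / t i).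

(** The list s stands for the exponential sum; repetitions are allowed, so that
    sums and products of expressions need no collecting of terms. *)
Definition localizes_to (E : finType) u v (t : E -> R) (X : {set E})
    (f : nat -> R) V : Prop :=
  exists s : seq (R * {set E}),
    [/\ forall q, q \in s -> q.2 \subset X,
        forall k, (0 < k)%N -> f k = \sum_(q <- s) q.1 * (\prod_(i in q.2) t i) ^+ k
      & \sum_(q <- s) q.1 * vertex_weight u v t X q.2 = V].

Lemma localizes_to_ext (E : finType) u v (t : E -> R) X f g V :
  (forall k, (0 < k)%N -> f k = g k) ->
  localizes_to u v t X f V -> localizes_to u v t X g V.
Proof. by move=> fg [s [? H ?]]; exists s; split=> // k k0; rewrite -fg ?H. Qed.

Lemma localizes_to_comb (E : finType) u v (t : E -> R) X f g V W (a b : R) :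
  localizes_to u v t X f V -> localizes_to u v t X g W ->
  localizes_to u v t X (fun k => a * f k + b * g k) (a * V + b * W).
Proof.
move=> [s [s1 s2 s3]] [r [r1 r2 r3]].
exists ([seq (a * q.1, q.2) | q <- s] ++ [seq (b * q.1, q.2) | q <- r]); split.
- by move=> q; rewrite mem_cat => /orP[] /mapP[p pin ->] /=; [exact: s1|exact: r1].
- move=> k k0; rewrite s2 // r2 // big_cat !big_map !mulr_sumr.
  by congr (_ + _); apply: eq_bigr => q _; rewrite mulrA.
- rewrite -s3 -r3 big_cat !big_map !mulr_sumr.
  by congr (_ + _); apply: eq_bigr => q _; rewrite mulrA.
Qed.

(** Enlarging the ground set by X without changing the sequence multiplies the
    value by this product. *)
Lemma localizes_to_one (E : finType) u v (t : E -> R) X :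
  localizes_to u v t X (fun=> 1) (\prod_(i in X) (1 + v / t i)).
Proof.
exists [:: (1, finset.set0)]; split.
- by move=> q; rewrite inE => /eqP ->; rewrite finset.sub0set.
- by move=> k _; rewrite big_seq1 /= big_set0 expr1n mulr1.
- by rewrite big_seq1 /= /vertex_weight big_set0 !mul1r finset.setD0.
Qed.

Lemma localizes_to_mul (E : finType) u v (t : E -> R) (X Y : {set E}) f g V W :
  [disjoint X & Y] -> localizes_to u v t X f V -> localizes_to u v t Y g W ->
  localizes_to u v t (X :|: Y) (fun k => f k * g k) (V * W).
Proof.
move=> dXY [s [s1 s2 s3]] [r [r1 r2 r3]].
exists [seq (p.1 * q.1, p.2 :|: q.2) | p <- s, q <- r].
have prodU (A B : {set E}) (F : E -> R) : A \subset X -> B \subset Y ->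
    \prod_(i in A :|: B) F i = \prod_(i in A) F i * \prod_(i in B) F i.
  move=> AX BY; rewrite (eq_bigl (fun A => _) _ (fun i => finset.in_setU i A B)).
  rewrite -bigU /=; first by apply: eq_bigl => i; rewrite inE.
  by apply: disjointWl AX _; apply: disjointWr BY _.
split.
- move=> _ /allpairsP[[p q] [/= pin qin ->]] /=.
  by apply: finset.setUSS; [exact: s1|exact: r1].
- move=> k k0; rewrite s2 // r2 // big_allpairs_dep /= big_distrlr /=.
  rewrite big_seq [RHS]big_seq; apply: eq_bigr => p pin.
  rewrite big_seq [RHS]big_seq; apply: eq_bigr => q qin.
  by rewrite prodU ?s1 ?r1 // exprMn mulrACA.
- rewrite -s3 -r3 big_allpairs_dep /= big_distrlr /=.
  rewrite big_seq [RHS]big_seq; apply: eq_bigr => p pin.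
  rewrite big_seq [RHS]big_seq; apply: eq_bigr => q qin.
  have pX := s1 _ pin; have qY := r1 _ qin.
  have XYE : (X :|: Y) :\: (p.2 :|: q.2) = (X :\: p.2) :|: (Y :\: q.2).
    apply/finset.setP => z; rewrite !inE.
    have := fun h : z \in X => disjointFr dXY h.
    have := fintype.subsetP pX z; have := fintype.subsetP qY z.
    case: (z \in X); case: (z \in Y); case: (z \in p.2); case: (z \in q.2);
      move=> H1 H2 H3; first
        [done | by have := H1 isT | by have := H2 isT | by have := H3 isT].
  by rewrite /vertex_weight XYE !prodU ?finset.subsetDl //; ring.
Qed.

Lemma localizes_to_map (E F : finType) u v (t : F -> R) (h : E -> F)
    (X : {set E}) f V : injective h ->
  localizes_to u v (t \o h) X f V -> localizes_to u v t (h @: X) f V.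
Proof.
move=> injh [s [s1 s2 s3]].
exists [seq (q.1, h @: (q.2 : {set E})) | q <- s]; split.
- by move=> _ /mapP[q qin ->]; apply: imsetS; exact: s1.
- move=> k k0; rewrite s2 // big_map; apply: eq_bigr => q _.
  by rewrite big_imset //= => x y _ _; exact: injh.
- rewrite -s3 big_map; apply: eq_bigr => q _; congr (_ * _).
  have hD : (h @: X) :\: (h @: q.2) = h @: (X :\: q.2).
    apply/finset.setP => z; rewrite inE.
    apply/andP/imsetP => [[zN /imsetP[x xX zx]]|[x]].
      exists x; rewrite // inE xX andbT; apply: contra zN => xq.
      by rewrite zx imset_f.
    by rewrite inE => /andP[xq xX] ->; rewrite mem_imset // imset_f.
  by rewrite /vertex_weight hD !big_imset //= => x y _ _; exact: injh.
Qed.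

Lemma localizes_to_dual (E : finType) u v (t : E -> R) f V :
  (forall e, t e != 0) ->
  localizes_to v u (fun e => (t e)^-1) finset.setT f V ->
  localizes_to u v t finset.setT (fun k => (\prod_e t e) ^+ k * f k) V.
Proof.
move=> t0 [s [s1 s2 s3]].
exists [seq (q.1, ~: q.2) | q <- s]; split.
- by move=> q _; exact: finset.subsetT.
- move=> k k0; rewrite s2 // mulr_sumr big_map; apply: eq_bigr => q _ /=.
  rewrite mulrCA -exprMn; congr (_ * _ ^+ _).
  rewrite (bigID (mem q.2)) /= mulrC mulrA -big_split /=.
  rewrite big1 ?mul1r => [|i _]; last by rewrite mulVf.
  by apply: eq_bigl => i; rewrite inE.
- rewrite -s3 big_map; apply: eq_bigr => q _; congr (_ * _).
  rewrite /vertex_weight mulrC /= finset.setTD finset.setCK; congr (_ * _).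
  by rewrite finset.setTD; apply: eq_bigr => i _; rewrite invrK.
Qed.

(** Direct sums multiply both the sequence and its value. *)
Lemma localizes_to_prod (I E : finType) u v (t : E -> R) (X : I -> {set E})
    (f : I -> nat -> R) (V : I -> R) :
  (forall i j, i != j -> [disjoint X i & X j]) ->
  (forall i, localizes_to u v t (X i) (f i) (V i)) ->
  localizes_to u v t (\bigcup_i X i) (fun k => \prod_i f i k) (\prod_i V i).
Proof.
move=> dX H.
suff: forall r : seq I, uniq r -> localizes_to u v t (\bigcup_(i <- r) X i)
    (fun k => \prod_(i <- r) f i k) (\prod_(i <- r) V i).
  by apply; exact: index_enum_uniq.
elim=> [_|i r IH /= /andP[ir ur]].
  rewrite !big_nil; have := localizes_to_one u v t finset.set0; rewrite big_set0.
  by apply: localizes_to_ext => k _; rewrite big_nil.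
have dXr : [disjoint X i & \bigcup_(j <- r) X j].
  rewrite big_seq; apply: (big_ind (fun Y : {set E} => [disjoint X i & Y])).
  - by rewrite -setI_eq0 finset.setI0.
  - by move=> Y Z; rewrite -!setI_eq0 finset.setIUr => /eqP-> /eqP->; rewrite finset.setU0.
  - by move=> j jr; apply: dX; apply: contra ir => /eqP ->.
rewrite !big_cons; apply: localizes_to_ext (localizes_to_mul dXr (H i) (IH ur)).
by move=> k _; rewrite big_cons.
Qed.
End Localization.

(** * The localized value of a sum of series-parallel matroids *)

Section SeriesParallel.
Variable R : realFieldType.
Implicit Types u v V W : R.

(** The value of a parallel extension, before assuming that the value of M does
    not depend on t; this generality also covers the coloop, from which the
    uniform matroid of rank 1 on 2 elements arises. *)
Lemma localizes_to_parallel (E : finType) (M : matroid E) (e : E) u v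
    (t : option E -> R) V W :
  ~~ is_loop M e -> (forall o, t o != 0) -> t (Some e) != t None ->
  localizes_to u v (t \o Some) finset.setT (lattice_sum M (t \o Some)) V ->
  localizes_to u v (fun i => t (if i == e then None else Some i)) finset.setT
    (lattice_sum M (fun i => t (if i == e then None else Some i))) W ->
  localizes_to u v t finset.setT (lattice_sum (parallel_ext M e) t)
    (((t None + v) * V - (t (Some e) + v) * W) / (t (Some e) - t None)).
Proof.
move=> loopNe t0 tne HV HW; pose h i := if i == e then None else Some i.
have d0 : t (Some e) - t None != 0 by rewrite subr_eq0.
have extend (h' : E -> option E) o f Z : injective h' -> h' @: finset.setT = ~: [set o] ->
    localizes_to u v (t \o h') finset.setT f Z ->
    localizes_to u v t finset.setT f (Z * (1 + v / t o)).
  move=> injh him /(localizes_to_map injh); rewrite him => Hf.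
  have := localizes_to_mul _ Hf (localizes_to_one u v t [set o]).
  rewrite big_set1 finset.setUC finset.setUCr => H.
  apply: localizes_to_ext (H _); first by move=> k _; rewrite mulr1.
  by rewrite disjoint_sym finset.disjoints_subset finset.setCK.
have Some_inj : injective (@Some E) by move=> ? ? [].
have h_inj : injective h.
  by move=> i j; rewrite /h; case: eqVneq => [->|_]; case: eqVneq => // _ [].
have im1 : (@Some E) @: finset.setT = ~: [set None].
  apply/finset.setP => -[i|]; rewrite !inE ?mem_imset //; first by rewrite inE.
  by apply/negP => /imsetP[].
have im2 : h @: finset.setT = ~: [set Some e].
  apply/finset.setP => o; rewrite !inE; apply/imsetP/idP => [[i _ ->]|].
    by rewrite /h; case: (eqVneq i e) => // ie; apply: contra ie => /eqP[->].
  case: o => [i|] oe.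
    by exists i; rewrite ?inE // /h; case: eqVneq => // ie; rewrite ie eqxx in oe.
  by exists e; rewrite ?inE // /h eqxx.
have := localizes_to_comb (t None / (t (Some e) - t None))
  (- (t (Some e)) / (t (Some e) - t None))
  (extend _ _ _ _ Some_inj im1 HV) (extend _ _ _ _ h_inj im2 HW).
rewrite (_ : _ * _ + _ * _ = ((t None + v) * V - (t (Some e) + v) * W) / (t (Some e) - t None)).
  apply: localizes_to_ext => k _; apply: (mulfI d0).
  by rewrite (lattice_sum_parallel _ _ loopNe); field.
by field; rewrite d0 !t0.
Qed.

(** For a coloop the only lattice point is k itself, and the value depends on t. *)
Lemma localizes_to_uniform11 u v (t : 'I_1 -> R) :
  localizes_to u v t finset.setT (lattice_sum (@uniform_matroid 1 1 isT) t)
    (1 + u * t ord0).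
Proof.
have setT1 : finset.setT = [set ord0] :> {set 'I_1}.
  by apply/finset.setP => i; rewrite !inE ord1.
have bE : bases (@uniform_matroid 1 1 isT) = [set finset.setT].
  apply/finset.setP => B; rewrite !inE; apply/eqP/eqP => [c|->].
    by apply/eqP; rewrite eqEcard finset.subsetT cardsT card_ord c.
  by rewrite cardsT card_ord.
exists [:: (1, finset.setT)]; split.
- by move=> q; rewrite inE => /eqP ->; rewrite finset.subsetT.
- move=> k k0; rewrite big_seq1 mul1r /= setT1 big_set1 /lattice_sum.
  rewrite (big_pred1 [ffun=> ord_max]) => [|x].
    by rewrite big_ord_recl big_ord0 mulr1 ffunE.
  apply/asboolP/eqP => [[w [_ ws wx]]|->].
    apply/ffunP => i; rewrite ffunE; apply/val_inj => /=; apply/eqP.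
    rewrite -(eqr_nat R) -wx -ws bE.
    by rewrite big_set1 big_mkcondr big_set1 inE.
  exists (fun=> k%:R); split => [B _||i]; first by rewrite ltr0n.
    by rewrite bE big_set1.
  by rewrite bE big_mkcondr big_set1 inE ffunE.
- by rewrite big_seq1 /vertex_weight finset.setDv big_set0 setT1 big_set1 mul1r mulr1.
Qed.

(** The base case of the induction is itself a parallel extension. *)
Lemma uniform12_parallel : matroid_iso
  (parallel_ext (@uniform_matroid 1 1 isT) ord0) (@uniform_matroid 1 2 isT).
Proof.
pose f (o : option 'I_1) : 'I_2 := if o is Some _ then ord0 else ord_max.
have fbij : bijective f.
  exists (fun i : 'I_2 => if i == ord0 then Some ord0 else None).
    by case=> [i|] //=; rewrite (ord1 i).
  by case=> [[|[|//]] h]; apply/val_inj.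
exists f => //; have finj := bij_inj fbij.
have bE : bases (parallel_ext (@uniform_matroid 1 1 isT) ord0) =
    [set A : {set option 'I_1} | #|A| == 1%N].
  apply/finset.setP => A; rewrite [RHS]inE.
  apply/parallel_basesP/idP => [[nA]|/cards1P[o ->]]; last first.
    split; first by rewrite !inE; case: o.
    by rewrite inE imset_set1 cards1.
  rewrite inE card_in_imset // => -[i|] [j|] // iA jA _.
  - by rewrite (ord1 i) (ord1 j).
  - by move: nA; rewrite -[ord0](ord1 i : i = ord0) iA jA.
  - by move: nA; rewrite -[ord0](ord1 j : j = ord0) iA jA.
rewrite bE; apply/finset.setP => B; rewrite inE.
apply/idP/imsetP => [cB|[A]]; last by rewrite inE => cA ->; rewrite card_imset.
case: (fbij) => g fK gK.
have BE : f @: (g @: B) = B by rewrite -imset_comp (eq_imset _ gK) imset_id.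
by exists (g @: B); rewrite ?BE // inE -(card_imset _ finj) BE.
Qed.

(** When V = W = c (1 - uv), the value of the parallel extension is
    c (1 - uv) ((t' + v) - (t_e + v)) / (t_e - t') = - c (1 - uv): every
    extension only changes the sign. *)
Lemma series_parallel_localizes (E : finType) (M : matroid E) :
  series_parallel M -> forall u v (t : E -> R), (forall e, t e != 0) -> injective t ->
  localizes_to u v t finset.setT (lattice_sum M t)
    ((-1) ^+ #|E|.+1 * (1 - u * v)).
Proof.
have iso (E1 F : finType) (M1 : matroid E1) (N : matroid F) u v (t : F -> R) V :
    matroid_iso M1 N ->
    (forall f : E1 -> F, bijective f ->
     localizes_to u v (t \o f) finset.setT (lattice_sum M1 (t \o f)) V) ->
    localizes_to u v t finset.setT (lattice_sum N t) V.
  case=> f bf bN H; have := localizes_to_map (bij_inj bf) (H f bf).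
  have -> : f @: finset.setT = finset.setT.
    case: bf => g fK gK; apply/finset.setP => y; rewrite !inE.
    by rewrite -(gK y) imset_f.
  by apply: localizes_to_ext => k _; rewrite (lattice_sum_iso _ _ bf bN).
have par (E1 : finType) (M1 : matroid E1) e (hM : ~~ is_loop M1 e) u v :
   (forall t : E1 -> R, (forall e, t e != 0) -> injective t ->
      localizes_to u v t finset.setT (lattice_sum M1 t)
        ((-1) ^+ #|E1|.+1 * (1 - u * v))) ->
   forall t : option E1 -> R, (forall e, t e != 0) -> injective t ->
      localizes_to u v t finset.setT (lattice_sum (parallel_ext M1 e) t)
        ((-1) ^+ #|option E1 : finType|.+1 * (1 - u * v)).
  move=> IH t t0 injt.
  have tne : t (Some e) != t None by apply/eqP => /injt.
  have Some_inj : injective (@Some E1) by move=> ? ? [].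
  have H1 := IH (t \o Some) (fun i => t0 (Some i)) (inj_comp injt Some_inj).
  have H2 := IH (fun i => t (if i == e then None else Some i)) (fun i => t0 _).
  have := localizes_to_parallel hM t0 tne H1 (H2 _).
  rewrite (_ : _ / _ = (-1) ^+ #|option E1 : finType|.+1 * (1 - u * v)).
    apply=> i j /injt; by case: eqVneq => [->|_]; case: eqVneq => // _ [].
  rewrite card_option !exprS; field; by rewrite subr_eq0.
have dual (E1 : finType) (M1 : matroid E1) :
   (forall u v (t : E1 -> R), (forall e, t e != 0) -> injective t ->
      localizes_to u v t finset.setT (lattice_sum M1 t)
        ((-1) ^+ #|E1|.+1 * (1 - u * v))) ->
   forall u v (t : E1 -> R), (forall e, t e != 0) -> injective t ->
      localizes_to u v t finset.setT (lattice_sum (dual_matroid M1) t)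
        ((-1) ^+ #|E1|.+1 * (1 - u * v)).
  move=> IH u v t t0 injt.
  have := localizes_to_dual t0 (IH v u _ (fun e => _) _).
  move=> /(_ (fun e => invr_neq0 (t0 e)) (inj_comp invr_inj injt)).
  rewrite [v * u]mulrC; apply: localizes_to_ext => k _.
  by rewrite lattice_sum_dual.
elim=> {E M}.
- move=> u v t t0 injt; apply: iso uniform12_parallel _ => f bf.
  have tne : (t \o f) (Some ord0) != (t \o f) None.
    by apply/eqP => /injt/(bij_inj bf).
  have nl : ~~ is_loop (@uniform_matroid 1 1 isT) ord0.
    apply/forallPn; exists finset.setT; rewrite negb_imply negbK !inE.
    by rewrite cardsT card_ord.
  have := localizes_to_parallel nl (fun=> t0 _) tne
    (localizes_to_uniform11 u v _) (localizes_to_uniform11 u v _).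
  rewrite (_ : _ / _ = (-1) ^+ #|'I_2|.+1 * (1 - u * v)) //.
  rewrite card_ord eqxx /=; field; by rewrite subr_eq0.
- by move=> E M e _ IH nl u v; exact: par nl _ _ (IH u v).
- move=> E M e _ IH nl.
  exact: dual _ _ (fun u v => par _ _ _ nl u v (dual _ _ IH u v)).
- move=> E F M N _ IH iMN u v t t0 injt; apply: iso iMN _ => f bf.
  rewrite -(bij_eq_card bf); apply: IH => [e|]; first exact: t0.
  exact: inj_comp injt (bij_inj bf).
Qed.

Lemma sum_of_series_parallel_localizes (E : finType) (N : matroid E) (c : nat)
    (F : 'I_c -> finType) (M : forall i, matroid (F i)) :
  (forall i, series_parallel (M i)) -> matroid_iso (direct_sum M) N ->
  forall u v (t : E -> R), (forall e, t e != 0) -> injective t ->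
  localizes_to u v t finset.setT (lattice_sum N t)
    ((-1) ^+ #|E| * (u * v - 1) ^+ c).
Proof.
move=> spM [f bf bN] u v t t0 injt; have injf := bij_inj bf.
pose h i (x : F i) : E := f (Tagged F x).
have injTag i : injective (fun x : F i => Tagged F x).
  by move=> x y /eqP; rewrite eq_Tagged => /eqP.
have injh i : injective (@h i) by move=> x y /injf/injTag.
have H i := localizes_to_map (injh i) (series_parallel_localizes (spM i) u v
  (fun e => t0 (h i e)) (inj_comp injt (injh i))).
have dX i j : i != j -> [disjoint @h i @: finset.setT & @h j @: finset.setT].
  move=> ij; rewrite -setI_eq0; apply/eqP/finset.setP => z; rewrite !inE.
  apply/negP => /andP[/imsetP[x _ ->] /imsetP[y _ /injf/(congr1 tag)/= E']].
  by rewrite E' eqxx in ij.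
have := localizes_to_prod dX H.
have -> : \bigcup_i @h i @: finset.setT = finset.setT.
  apply/finset.setP => z; rewrite inE; apply/bigcupP.
  by case: bf => g fK gK; exists (tag (g z)) => //; apply/imsetP;
    exists (tagged (g z)); rewrite // /h -[LHS]gK; case: (g z).
have -> : \prod_i ((-1) ^+ #|F i|.+1 * (1 - u * v)) = (-1) ^+ #|E| * (u * v - 1) ^+ c.
  rewrite -(bij_eq_card bf) card_tagged sumnE big_map big_enum /= -prodrXr.
  under eq_bigr => i _ do rewrite exprS mulN1r mulNr -mulrN opprB.
  rewrite big_split /= prodr_const card_ord.
  by congr (_ * _); apply: eq_bigl.
apply: localizes_to_ext => k k0.
by rewrite (lattice_sum_iso _ _ bf bN) lattice_sum_direct_sum.
Qed.
End SeriesParallel.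

(** * The localized value is determined by the sequence *)

Section Uniqueness.
Variable R : realFieldType.
Implicit Types u v V W : R.

(** Lagrange interpolation with a prescribed zero at 0, which makes the
    polynomial a combination of the powers with positive exponent. *)
Lemma interpolation (T : finType) (a b : T -> R) :
  injective a -> (forall x, a x != 0) ->
  exists2 p : {poly R}, p`_0 = 0 & forall x, p.[a x] = b x.
Proof.
move=> inja a0.
(* The factor 'X provides the zero at 0. *)
pose q x : {poly R} := 'X * \prod_(y | y != x) ('X - (a y)%:P).
have qy x y : x != y -> (q x).[a y] = 0.
  move=> xy; rewrite /q hornerM horner_prod (bigD1 y) /= 1?eq_sym //.
  by rewrite hornerXsubC subrr mul0r mulr0.
have qx x : (q x).[a x] != 0.
  rewrite /q hornerM horner_prod hornerX mulf_neq0 //.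
  apply/prodf_neq0 => y yx; rewrite hornerXsubC subr_eq0.
  by apply: contra yx => /eqP/inja ->.
exists (\sum_x (b x / (q x).[a x]) *: q x).
  by rewrite coef_sum big1 // => x _; rewrite coefZ /q coefXM mulr0.
move=> x; rewrite horner_sum (bigD1 x) //= big1 ?addr0 => [|y yx].
  by rewrite hornerZ divfK.
by rewrite hornerZ (qy y x) // mulr0.
Qed.

Lemma binary_expansion_inj n (b b' : nat -> bool) :
  (\sum_(i < n) b i * 2 ^ i = \sum_(i < n) b' i * 2 ^ i)%N ->
  forall i, (i < n)%N -> b i = b' i.
Proof.
elim: n b b' => // n IH b b'; rewrite !big_ord_recl /= !expn0 !muln1.
have dbl (c : nat -> bool) : (\sum_(i < n) c (bump 0 i) * 2 ^ bump 0 i =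
    (\sum_(i < n) c i.+1 * 2 ^ i).*2)%N.
  rewrite -mul2n big_distrr /=; apply: eq_bigr => i _.
  by rewrite /bump /= add1n expnS mulnCA.
rewrite !dbl => E.
have b0 : b 0 = b' 0.
  by move/(congr1 odd): E; rewrite !oddD !odd_double !addbF !oddb.
move: E; rewrite b0 => /addnI/double_inj/(IH (b \o S) (b' \o S)) H.
by case=> [|i] //; rewrite ltnS => /H.
Qed.

Definition separating (E : finType) (t : E -> R) : Prop :=
  injective (fun A : {set E} => \prod_(i in A) t i) /\ forall e, t e != 0.

Lemma separating_inj (E : finType) (t : E -> R) : separating t -> injective t.
Proof.
move=> [inj _] i j ij; apply: finset.set1_inj; apply: inj.
by rewrite !big_set1.
Qed.

(** The exponent of the product over A is the number with binary digits A. *)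
Lemma separating_exists n : separating (fun i : 'I_n => 2%:R ^+ (2 ^ i)%N : R).
Proof.
split=> [A B|e]; last by rewrite expf_neq0 // pnatr_eq0.
rewrite !prodrXr => /eqP; rewrite -!natrX eqr_nat eqn_exp2l // => /eqP AB.
pose mem_nat (C : {set 'I_n}) (k : nat) : bool :=
  if insub k is Some j then j \in C else false.
have mem_natE C (i : 'I_n) : mem_nat C i = (i \in C).
  by rewrite /mem_nat (valK i).
have H (C : {set 'I_n}) : (\sum_(i in C) 2 ^ i = \sum_(i < n) mem_nat C i * 2 ^ i)%N.
  rewrite big_mkcond; apply: eq_bigr => i _; rewrite mem_natE.
  by case: (i \in C); rewrite ?mul1n ?mul0n.
apply/finset.setP => i; rewrite !H in AB.
by have := binary_expansion_inj AB (ltn_ord i); rewrite !mem_natE.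
Qed.

(** If p(t^A) = w_A for all A and p(0) = 0, then the value is obtained from the
    sequence by taking the combination of its terms with the coefficients
    of p. *)
Lemma localizes_to_unique (E : finType) u v (t : E -> R) X f g V W :
  separating t -> (forall k, (0 < k)%N -> f k = g k) ->
  localizes_to u v t X f V -> localizes_to u v t X g W -> V = W.
Proof.
move=> [inj t0] fg Hf Hg; apply/eqP; rewrite -subr_eq0; apply/eqP.
have [s [_ s2]] := localizes_to_comb 1 (-1) Hf Hg.
rewrite mul1r mulN1r => <-.
have nz (A : {set E}) : \prod_(i in A) t i != 0 by apply/prodf_neq0.
have [p p0 pA] := interpolation (vertex_weight u v t X) inj nz.
transitivity (\sum_(i < size p) p`_i *
    \sum_(q <- s) q.1 * (\prod_(j in q.2) t j) ^+ i).
  under [RHS]eq_bigr => i _ do rewrite mulr_sumr.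
  rewrite exchange_big; apply: eq_bigr => q _ /=.
  rewrite -pA horner_coef mulr_sumr; apply: eq_bigr => i _.
  by rewrite mulrCA.
rewrite big1 // => -[[|i] lt_i] _ /=; first by rewrite p0 mul0r.
by rewrite -s2 // fg // mul1r mulN1r subrr mulr0.
Qed.

Lemma localizes_to_sum (E : finType) u v (t : E -> R) X (I : eqType) (r : seq I)
    (f : I -> nat -> R) (V : I -> R) :
  (forall i, i \in r -> localizes_to u v t X (f i) (V i)) ->
  localizes_to u v t X (fun k => \sum_(i <- r) f i k) (\sum_(i <- r) V i).
Proof.
elim: r => [_|i r IH H].
  rewrite big_nil; exists [::]; split=> //; last by rewrite big_nil.
  by move=> k _; rewrite !big_nil.
have Hi := H i (mem_head _ _).
have {}IH := IH (fun j jr => H j (mem_behead (jr : j \in behead (i :: r)))).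
rewrite big_cons; have := localizes_to_comb 1 1 Hi IH; rewrite !mul1r.
by apply: localizes_to_ext => k _; rewrite big_cons !mul1r.
Qed.

(** Two polynomials that agree at all natural numbers have equal coefficients. *)
Lemma count_from_power_sums (I J : Type) (r : seq I) (r' : seq J)
    (c : I -> nat) (c' : J -> nat) :
  (forall y : R, \sum_(i <- r) y ^+ c i = \sum_(j <- r') y ^+ c' j) ->
  forall k, count (fun i => c i == k) r = count (fun j => c' j == k) r'.
Proof.
move=> H k.
pose p : {poly R} := \sum_(i <- r) 'X^(c i) - \sum_(j <- r') 'X^(c' j).
have p0 : p = 0.
  apply: (@roots_geq_poly_eq0 _ _ [seq i%:R | i <- iota 0 (size p)]).
  - apply/allP => _ /mapP[i _ ->]; rewrite /root /p hornerD hornerN !horner_sum.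
    under eq_bigr => j _ do rewrite hornerXn.
    under [X in _ - X]eq_bigr => j _ do rewrite hornerXn.
    by rewrite H subrr.
  - rewrite map_inj_uniq ?iota_uniq // => i j /eqP.
    by rewrite eqr_nat => /eqP.
  - by rewrite size_map size_iota.
have cE (K : Type) (s : seq K) (d : K -> nat) :
    (\sum_(i <- s) 'X^(d i) : {poly R})`_k = (count (fun i => d i == k) s)%:R.
  rewrite coef_sum -sum1_count natr_sum [RHS]big_mkcond; apply: eq_bigr => i _.
  by rewrite coefXn eq_sym; case: eqP.
have /eqP := congr1 (fun q : {poly R} => q`_k) p0.
by rewrite /p coefB !cE coef0 subr_eq0 eqr_nat => /eqP.
Qed.
End Uniqueness.

(** * Linear forms that are constant on the bases *)

Section Dimension.
Variable R : realFieldType.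

(** The form a is constant on the vertices of the polytope of M, hence on its
    affine span. *)
Definition constant_on_bases (E : finType) (M : matroid E) (a : E -> R) : Prop :=
  forall B B', B \in bases M -> B' \in bases M ->
    \sum_(i in B) a i = \sum_(i in B') a i.

Lemma constant_on_bases_iso (E F : finType) (M : matroid E) (N : matroid F)
    (f : E -> F) (a : F -> R) :
  injective f -> bases N = [set f @: (B : {set E}) | B in bases M] ->
  constant_on_bases N a <-> constant_on_bases M (a \o f).
Proof.
move=> injf bN.
have sumE (B : {set E}) : \sum_(i in f @: B) a i = \sum_(i in B) a (f i).
  by rewrite big_imset //= => x y _ _; exact: injf.
split=> [H B B' hB hB'|H _ _ /[!bN] /imsetP[B hB ->] /imsetP[B' hB' ->]].
  by rewrite /= -!sumE; apply: H; rewrite bN imset_f.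
by rewrite !sumE; exact: H.
Qed.

Lemma constant_on_bases_dual (E : finType) (M : matroid E) (a : E -> R) :
  constant_on_bases (dual_matroid M) a -> constant_on_bases M a.
Proof.
move=> H B B' hB hB'; apply: (addIr (\sum_(i in ~: B) a i)).
have sumE (C : {set E}) : \sum_(i in C) a i + \sum_(i in ~: C) a i = \sum_i a i.
  rewrite [RHS](bigID (mem C)); congr (_ + _).
  by apply: eq_bigl => i; rewrite inE.
rewrite sumE [X in _ + X](H _ (~: B')) ?sumE //; exact: imset_f.
Qed.

(** Exchanging e for its copy in a basis changes the sum by a(e') - a(e). *)
Lemma constant_on_bases_parallel (E : finType) (M : matroid E) (e : E)
    (a : option E -> R) : ~~ is_loop M e ->
  constant_on_bases (parallel_ext M e) a ->
  a None = a (Some e) /\ constant_on_bases M (a \o Some).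
Proof.
move=> /forallPn[B]; rewrite negb_imply negbK => /andP[hB eB] H.
have Some_inj : injective (@Some E) by move=> ? ? [].
have sumE (C : {set E}) : \sum_(i in Some @: C) a i = \sum_(i in C) a (Some i).
  by rewrite big_imset //= => x y _ _; exact: Some_inj.
have inS C : C \in bases M -> Some @: C \in bases (parallel_ext M e).
  by move=> hC; rewrite inE imset_f.
split; last first.
  by move=> C C' hC hC'; rewrite /= -!sumE; apply: H; exact: inS.
have := H (None |: Some @: (B :\ e)) (Some @: B).
rewrite inS // sumE big_setU1 /=; last by apply/negP => /imsetP[].
rewrite sumE (big_setD1 e eB) /= => /(_ _ isT)/addIr; apply.
rewrite inE; apply/orP; right; apply/imsetP; exists B => //.
by rewrite inE hB.
Qed.

(** This is connectedness of series-parallel matroids, in the form needed to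
    find the dimension of their polytopes. *)
Lemma series_parallel_constant (E : finType) (M : matroid E) :
  series_parallel M -> (0 < #|E|)%N /\
  forall a : E -> R, constant_on_bases M a -> forall i j, a i = a j.
Proof.
have par (E1 : finType) (M1 : matroid E1) e : ~~ is_loop M1 e ->
    (forall a : E1 -> R, constant_on_bases M1 a -> forall i j, a i = a j) ->
    forall a : option E1 -> R, constant_on_bases (parallel_ext M1 e) a ->
    forall i j, a i = a j.
  move=> hM IH a /(constant_on_bases_parallel hM)[aN /IH aS].
  by case=> [i|] [j|]; rewrite ?aN //; exact: aS.
elim=> {E M}.
- split=> [|a H i j]; first by rewrite card_ord.
  have := H [set i] [set j]; rewrite !big_set1; apply; by rewrite inE cards1.
- move=> E M e _ [_ IH] nl; split; first by rewrite card_option.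
  exact: par nl IH.
- move=> E M e _ [_ IH] nl; split; first by rewrite card_option.
  move=> a /constant_on_bases_dual; apply: par nl _ a => a'.
  by move/constant_on_bases_dual; exact: IH.
- move=> E F M N _ [E0 IH] [f bf bN]; split; first by rewrite -(bij_eq_card bf).
  move=> a /(constant_on_bases_iso _ (bij_inj bf) bN)/IH H i j.
  by case: bf => g _ gK; rewrite -(gK i) -(gK j); exact: H.
Qed.

Lemma sum_over_components (I : finType) (E : I -> finType)
    (a : {i : I & E i} -> R) (A : {set {i : I & E i}}) :
  \sum_(x in A) a x = \sum_i \sum_(y in component A i) a (Tagged E y).
Proof.
rewrite sig_big_dep /=; apply: eq_big => [[i y]|[i y] _ //].
by rewrite inE.
Qed.

Lemma constant_on_bases_direct_sum (I : finType) (E : I -> finType)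
    (M : forall i, matroid (E i)) (a : {i : I & E i} -> R) :
  constant_on_bases (direct_sum M) a ->
  forall i, constant_on_bases (M i) (fun x => a (Tagged E x)).
Proof.
move=> H i B B' hB hB'; have /set0Pn[A0 hA0] := dsum_bases_neq0 M.
have [A [hA Ai Aj]] := direct_sum_replace_component hA0 hB.
have [A' [hA' Ai' Aj']] := direct_sum_replace_component hA0 hB'.
have := H _ _ hA hA'; rewrite !sum_over_components (bigD1 i) //= [RHS](bigD1 i) //=.
rewrite Ai Ai' [X in _ + X = _](eq_bigr (fun j =>
  \sum_(y in component A' j) a (Tagged E y))) => [/addIr //|j ji].
by rewrite Aj // Aj'.
Qed.

(** The map kappa sends an element to its summand. *)
Lemma constant_on_components (E : finType) (N : matroid E) (c : nat)
    (F : 'I_c -> finType) (M : forall i, matroid (F i)) :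
  (forall i, series_parallel (M i)) -> matroid_iso (direct_sum M) N ->
  exists kappa : E -> 'I_c, (forall i, exists e, kappa e = i) /\
    forall a : E -> R, constant_on_bases N a <-> exists b, a =1 b \o kappa.
Proof.
move=> spM [f bf bN]; case: (bf) => g fK gK.
exists (fun e => tag (g e)); split=> [i|a].
  have [/card_gt0P[x _] _] := series_parallel_constant (spM i).
  by exists (f (Tagged F x)); rewrite fK.
split=> [/(constant_on_bases_iso _ (bij_inj bf) bN)/constant_on_bases_direct_sum H|].
  have pt i : {x : F i | true}.
    have [/card_gt0P H0 _] := series_parallel_constant (spM i).
    by exists (xchoose H0).
  exists (fun i => a (f (Tagged F (sval (pt i))))) => e /=.
  rewrite -{1}(gK e); case: (g e) => i x /=.
  by have [_ /(_ _ (H i))] := series_parallel_constant (spM i); exact.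
case=> b ab; apply/(constant_on_bases_iso _ (bij_inj bf) bN) => A A'.
rewrite !inE => /forallP hA /forallP hA'; rewrite !sum_over_components.
apply: eq_bigr => i _.
have sE (C : {set F i}) : \sum_(y in C) (a \o f) (Tagged F y) = b i *+ #|C|.
  by rewrite -sumr_const; apply: eq_bigr => y _; rewrite /= ab /= fK.
by rewrite !sE (card_bases (hA i) (hA' i)).
Qed.
End Dimension.

(** * Relative interiors and faces of convex hulls *)

Section Geometry.
Variables (R : realType) (n : nat).
Local Notation V := 'rV[R]_n.
Local Open Scope classical_set_scope.
Implicit Types (C F G : set V) (x y : V).

Definition hull (m : nat) (p : 'I_m -> V) : set V :=
  [set x | exists w : 'I_m -> R,
    [/\ forall i, 0 <= w i, \sum_i w i = 1 & x = \sum_i w i *: p i]].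

(** Every segment of C ending at x can be prolonged within C.  This description
    does not refer to the topology, to the vertices or to the affine span. *)
Definition intrinsic_interior C : set V :=
  [set x | C x /\ forall y, C y -> exists2 e : R, 0 < e & C (x + e *: (x - y))].

Lemma convex_hull_range (m : nat) (p : 'I_m -> V) : convex_hull (range p) = hull p.
Proof.
apply/seteqP; split=> x.
  move=> [k [q [w [qp w0 w1 xE]]]].
  have H i : exists j, p j = q i by have [j _ <-] := qp i; exists j.
  pose f i := sval (cid (H i)).
  have fE i : p (f i) = q i by rewrite /f; case: (cid _).
  exists (fun j => \sum_(i | f i == j) w i); split.
  - by move=> j; apply: sumr_ge0.
  - by rewrite -w1 [RHS](partition_big f xpredT).
  - rewrite xE (partition_big f xpredT) //=; apply: eq_bigr => j _.
    by rewrite scaler_suml; apply: eq_bigr => i /eqP <-; rewrite fE.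
move=> [w [w0 w1 xE]]; exists m, p, w; split=> // i.
Qed.

Lemma polytope_hull C : is_polytope C -> exists m (p : 'I_m -> V), C = hull p.
Proof.
move=> [A /finite_seqP[s ->] ->]; exists (size s), (fun i => nth 0 s i).
rewrite -convex_hull_range; congr convex_hull; apply/seteqP; split=> x /=.
  by move=> xs; exists (Ordinal (etrans (index_mem x s) xs)) => //=; rewrite nth_index.
by move=> [i _ <-]; rewrite mem_nth.
Qed.

Lemma hull_vertex (m : nat) (p : 'I_m -> V) i : hull p (p i).
Proof.
exists (fun j => (j == i)%:R); split=> [j||]; first by rewrite ler0n.
  by rewrite (bigD1 i) //= eqxx big1 ?addr0 // => j /negPf ->.
rewrite (bigD1 i) //= eqxx scale1r big1 ?addr0 // => j /negPf ->.
by rewrite scale0r.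
Qed.

Lemma positive_lower_bound (m : nat) (w : 'I_m -> R) :
  (forall i, 0 < w i) -> exists2 e : R, 0 < e & forall i, e <= w i.
Proof.
move=> w0; exists (\big[Order.min/1]_i w i); last by move=> i; exact: bigmin_le.
by apply: (big_ind (fun a : R => 0 < a)) => // a b a0 b0; rewrite lt_min a0.
Qed.

(** Prolonging the segment from the barycenter of the points p i to x makes all
    weights of x positive; conversely, positive weights leave room to subtract
    a small multiple of any other weights. *)
Lemma intrinsic_interior_hullP (m : nat) (p : 'I_m -> V) x :
  intrinsic_interior (hull p) x <-> exists w : 'I_m -> R,
    [/\ forall i, 0 < w i, \sum_i w i = 1 & x = \sum_i w i *: p i].
Proof.
split=> [[[w0 [w00 w01 xE0]] H]|[w [w0 w1 xE]]].
  have m0 : (0 < m)%N.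
    case: m p w0 w00 w01 {H xE0} => // p w0 _.
    by rewrite big_ord0 => /esym/eqP; rewrite oner_eq0.
  have m0' : (0 : R) < m%:R by rewrite ltr0n.
  pose y := \sum_i (m%:R^-1 : R) *: p i.
  have [|e e0 [u [u0 u1 uE]]] := H y.
    exists (fun=> m%:R^-1); split=> //; first by move=> _; rewrite invr_ge0 ltW.
    by rewrite sumr_const card_ord -[LHS]mulr_natl divff // gt_eqF.
  have e1 : 0 < 1 + e by rewrite addr_gt0.
  exists (fun i => (1 + e)^-1 * (u i + e / m%:R)); split.
  - by move=> i; rewrite mulr_gt0 ?invr_gt0 // ltr_wpDl // divr_gt0.
  - rewrite -mulr_sumr big_split /= u1 sumr_const card_ord -[_ / _ *+ m]mulr_natr divfK.
      by rewrite mulVf // gt_eqF.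
    by rewrite gt_eqF.
  - transitivity ((1 + e)^-1 *: (x + e *: (x - y) + e *: y)).
      rewrite -addrA -scalerDr subrK (_ : x + e *: x = (1 + e) *: x); last first.
        by rewrite scalerDl scale1r.
      by rewrite scalerA mulVf ?scale1r // gt_eqF.
    rewrite uE /y scaler_sumr -big_split /= scaler_sumr; apply: eq_bigr => i _.
    by rewrite !scalerA -scalerDl scalerA.
split; first by exists w; split=> // i; exact: ltW.
move=> y [u [u0 u1 yE]]; have [e e0 ew] := positive_lower_bound w0.
have u01 i : u i <= 1.
  by rewrite -u1 (bigD1 i) //= lerDl; apply: sumr_ge0.
exists e => //; exists (fun i => w i + e * (w i - u i)); split.
- move=> i; have H1 := ew i; have H2 := u01 i; have H3 := w0 i.
  have H4 : e * u i <= w i by apply: le_trans H1; rewrite ler_piMr // ltW.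
  have : 0 < e * w i by rewrite mulr_gt0.
  by rewrite mulrBr; lra.
- by rewrite big_split /= -mulr_sumr sumrB w1 u1 subrr mulr0 addr0.
- rewrite xE yE -sumrB scaler_sumr -big_split /=; apply: eq_bigr => i _.
  by rewrite -scalerBl scalerA -scalerDl.
Qed.

Lemma intrinsic_interior_comb (m : nat) (p : 'I_m -> V) x y (a b : R) :
  intrinsic_interior (hull p) x -> hull p y -> 0 < a -> 0 <= b -> a + b = 1 ->
  intrinsic_interior (hull p) (a *: x + b *: y).
Proof.
move=> /intrinsic_interior_hullP[w [w0 w1 ->]] [u [u0 u1 ->]] a0 b0 ab.
apply/intrinsic_interior_hullP; exists (fun i => a * w i + b * u i); split.
- by move=> i; rewrite ltr_pwDl ?mulr_ge0 ?mulr_gt0.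
- by rewrite big_split /= -!mulr_sumr w1 u1 !mulr1.
- rewrite !scaler_sumr -big_split; apply: eq_bigr => i _ /=.
  by rewrite !scalerA scalerDl.
Qed.

Lemma affine_hull_hull (m : nat) (p : 'I_m -> V) :
  affine_hull (hull p) = [set x | exists2 w : 'I_m -> R,
    \sum_i w i = 1 & x = \sum_i w i *: p i].
Proof.
apply/seteqP; split=> x /=.
  move=> [k [q [w [qp w1 ->]]]].
  pose u i := sval (cid (qp i)).
  have u1 i : \sum_j u i j = 1 by rewrite /u; case: (cid _) => ? [].
  have uE i : q i = \sum_j u i j *: p j by rewrite /u; case: (cid _) => ? [].
  exists (fun j => \sum_i w i * u i j).
    rewrite exchange_big /= -w1; apply: eq_bigr => i _.
    by rewrite -mulr_sumr u1 mulr1.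
  transitivity (\sum_i \sum_j (w i * u i j) *: p j).
    by apply: eq_bigr => i _; rewrite uE scaler_sumr; apply: eq_bigr => j _; rewrite scalerA.
  by rewrite exchange_big; apply: eq_bigr => j _; rewrite scaler_suml.
move=> [w w1 ->]; exists m, p, w; split=> // i; exact: hull_vertex.
Qed.

(** A point of the affine span near x is x + b A with b small, where A has the
    rows p i - p 0: the pseudo-inverse of A is bounded.  Small changes of
    positive weights keep them positive. *)
Lemma rel_interior_hull (m : nat) (p : 'I_m -> V) :
  rel_interior (hull p) = intrinsic_interior (hull p).
Proof.
apply/seteqP; split=> x.
  move=> [xP nearP]; split=> // y yP.
  have /nbhs_ballP[e /= e0 H] :
    nbhs x [set z | affine_hull (hull p) z -> hull p z] := nearP.
  have [N N0 HN] : exists2 N : R, 0 < N & forall j, `|x 0 j - y 0 j| < N.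
    exists (1 + \sum_j `|x 0 j - y 0 j|).
      by rewrite ltr_pwDl // sumr_ge0.
    move=> j; rewrite ltr_pwDl // (bigD1 j) //= lerDl; exact: sumr_ge0.
  exists (e / N); first by rewrite divr_gt0.
  apply: H.
    split=> // i j; rewrite ord1 -ball_normE /= !mxE opprD addrA subrr sub0r normrN.
    by rewrite normrM gtr0_norm ?divr_gt0 // -mulrA gtr_pMr // mulrC ltr_pdivrMr // mul1r.
  case: xP => w [_ w1 ->]; case: yP => u [_ u1 ->]; rewrite affine_hull_hull.
  exists (fun i => w i + e / N * (w i - u i)).
    by rewrite big_split /= -mulr_sumr sumrB w1 u1 subrr mulr0 addr0.
  rewrite -sumrB scaler_sumr -big_split /=; apply: eq_bigr => i _.
  by rewrite -scalerBl scalerA -scalerDl.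
move=> xI; split; first by case: xI.
have [w [w0 w1 xE]] := (intrinsic_interior_hullP _ _).1 xI.
case: m p w w0 w1 xE {xI} => [|m] p w w0 w1 xE.
  by move: w1; rewrite big_ord0 => /esym/eqP; rewrite oner_eq0.
pose A := \matrix_(i, j) (p i 0 j - p ord0 0 j) : 'M[R]_(m.+1, n).
pose Q := pinvmx A.
(* K bounds the weights b = (y - x) Q, in the sum norm, by the coordinates of
   y - x in the maximum norm. *)
pose K := 1 + \sum_j \sum_i `|Q j i|.
have K0 : 0 < K by rewrite ltr_pwDl // sumr_ge0 // => i _; rewrite sumr_ge0.
have [e e0 ew] := positive_lower_bound w0.
apply/nbhs_ballP; exists (e / (2 * K)) => /=; first by rewrite divr_gt0 ?mulr_gt0.
move=> y xy; rewrite affine_hull_hull => -[c c1 yE].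
pose b := (y - x) *m Q.
have bA : b *m A = y - x.
  rewrite mulmxKpV //; apply/submxP; exists (\row_i (c i - w i)).
  apply/rowP => j; rewrite yE xE -sumrB summxE !mxE.
  under eq_bigr => i _ do rewrite -scalerBl mxE.
  under [RHS]eq_bigr => i _ do rewrite !mxE mulrBr.
  by rewrite sumrB -mulr_suml sumrB c1 w1 subrr mul0r subr0.
have sb : \sum_i `|b 0 i| <= e / 2.
  have -> : e / 2 = e / (2 * K) * K by field; rewrite gt_eqF.
  apply: (@le_trans _ _ (\sum_i \sum_j e / (2 * K) * `|Q j i|)).
    apply: ler_sum => i _; rewrite mxE; apply: le_trans (ler_norm_sum _ _ _) _.
    apply: ler_sum => j _; rewrite normrM ler_wpM2r //.
    have := xy.2 0 j; rewrite -ball_normE /= !mxE distrC; exact: ltW.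
  rewrite exchange_big /=; under eq_bigr => i _ do rewrite -mulr_sumr.
  rewrite -mulr_sumr ler_wpM2l ?lerDr //.
  by rewrite divr_ge0 ?mulr_ge0 ?ltW.
clearbody b.
(* The rows of A are differences with p 0, whose weight absorbs the total of b. *)
exists (fun i => w i + b 0 i - (i == ord0)%:R * \sum_j b 0 j); split.
- move=> i; have bi : `|b 0 i| <= e / 2.
    by apply: le_trans sb; rewrite (bigD1 i) //= lerDl sumr_ge0.
  have bs : `|\sum_j b 0 j| <= e / 2 by apply: le_trans sb; exact: ler_norm_sum.
  have := ew i; move: bi bs; rewrite !ler_norml => /andP[b1 b2] /andP[b3 b4] ei.
  by case: eqP => _; rewrite ?mul1r ?mul0r; lra.
- rewrite sumrB big_split /= w1 -[X in _ - X]mulr_suml.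
  rewrite [X in _ - X * _](bigD1 ord0) //= [X in _ - (_ + X) * _]big1.
    by rewrite addr0 mul1r addrK.
  by move=> i /negPf ->.
- have -> : y = x + b *m A by rewrite bA addrC subrK.
  transitivity (\sum_i w i *: p i + \sum_i b 0 i *: p i - (\sum_j b 0 j) *: p ord0).
    rewrite -xE -addrA; congr (_ + _); apply/rowP => j; rewrite !mxE summxE.
    under eq_bigr => i _ do rewrite !mxE mulrBr.
    rewrite sumrB -mulr_suml; congr (_ - _).
    by apply: eq_bigr => i _; rewrite mxE.
  have -> : (\sum_j b 0 j) *: p ord0 =
      \sum_i ((i == ord0)%:R * \sum_j b 0 j) *: p i.
    rewrite [RHS](bigD1 ord0) //= mul1r [X in _ = _ + X]big1 ?addr0 //.
    by move=> i /negPf ->; rewrite mul0r scale0r.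
  rewrite -big_split -sumrB; apply: eq_bigr => i _ /=.
  by rewrite -scalerDl -scalerBl.
Qed.

Definition dot (a x : V) : R := \sum_i a 0 i * x 0 i.

Lemma dotDr a x y : dot a (x + y) = dot a x + dot a y.
Proof. by rewrite -big_split; apply: eq_bigr => i _; rewrite mxE mulrDr. Qed.

Lemma dotZr a (c : R) x : dot a (c *: x) = c * dot a x.
Proof. by rewrite mulr_sumr; apply: eq_bigr => i _; rewrite mxE mulrCA. Qed.

Lemma dotBr a x y : dot a (x - y) = dot a x - dot a y.
Proof. by rewrite -scaleN1r dotDr dotZr mulN1r. Qed.

Lemma dotC a x : dot a x = dot x a.
Proof. by apply: eq_bigr => i _; rewrite mulrC. Qed.

Lemma dot_sumr (I : Type) (r : seq I) (P : pred I) a (f : I -> V) :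
  dot a (\sum_(i <- r | P i) f i) = \sum_(i <- r | P i) dot a (f i).
Proof.
apply: (big_morph (dot a)) => [x y|]; first exact: dotDr.
by rewrite -(scale0r 0) dotZr mul0r.
Qed.

Lemma dot_comb (m : nat) (p : 'I_m -> V) (w : 'I_m -> R) a :
  dot a (\sum_i w i *: p i) = \sum_i w i * dot a (p i).
Proof. by rewrite dot_sumr; apply: eq_bigr => i _; rewrite dotZr. Qed.

(** By induction on the number of vectors: a form a that separates b from all
    vectors but e, and fails at e, reduces the problem to the projections along
    e to the kernel of a. *)
Lemma farkas (m : nat) (d : 'I_m -> V) (b : V) :
  (exists2 w : 'I_m -> R, forall i, 0 <= w i & b = \sum_i w i *: d i) \/
  (exists2 a, forall i, dot a (d i) <= 0 & 0 < dot a b).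
Proof.
elim: m d b => [|m IH] d b.
  have [->|b0] := eqVneq b 0; first by left; exists (fun=> 0); rewrite ?big_ord0.
  right; exists b => [[]//|].
  have /existsP[j bj] : [exists j, b 0 j != 0].
    rewrite -negb_forall; apply: contra b0 => /forallP H; apply/eqP/rowP => j.
    by rewrite mxE; apply/eqP.
  rewrite /dot (bigD1 j) //= ltr_pwDl // -?expr2 ?exprn_even_gt0 //.
  by apply: sumr_ge0 => i _; rewrite -expr2 sqr_ge0.
pose d' i := d (lift ord0 i); pose e := d ord0.
have [[w w0 ->]|[a ad ab]] := IH d' b.
  left; exists (fun i => if unlift ord0 i is Some j then w j else 0).
    by move=> i; case: unliftP.
  rewrite big_ord_recl unlift_none scale0r add0r; apply: eq_bigr => i _.
  by rewrite liftK.
have [ae|ae] := leP (dot a e) 0.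
  by right; exists a => // i; case: (unliftP ord0 i) => [j|] -> //; exact: ad.
have ae0 : dot a e != 0 by rewrite gt_eqF.
(* The form a vanishes on the image of [proj], and [proj] kills e. *)
pose proj (x : V) := x - (dot a x / dot a e) *: e.
have [[w w0 bE]|[a' a'd a'b]] := IH (fun i => proj (d' i)) (proj b).
  (* The coefficient of e collects the multiples of e removed by [proj]. *)
  left; pose c := dot a b / dot a e - \sum_i w i * (dot a (d' i) / dot a e).
  exists (fun i => if unlift ord0 i is Some j then w j else c).
    move=> i; case: unliftP => [j _|_] //.
    rewrite /c subr_ge0; apply: (@le_trans _ _ 0); last first.
      by apply: divr_ge0; exact: ltW.
    apply: sumr_le0 => j _; rewrite mulr_ge0_le0 // mulr_le0_ge0 //.
    by rewrite invr_ge0 ltW.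
  rewrite big_ord_recl unlift_none.
  under eq_bigr => i _ do rewrite liftK.
  have -> : b = proj b + (dot a b / dot a e) *: e by rewrite subrK.
  rewrite bE /c scalerBl scaler_suml.
  have -> : \sum_i w i *: proj (d' i) = \sum_i w i *: d' i -
      \sum_i (w i * (dot a (d' i) / dot a e)) *: e.
    by rewrite -sumrB; apply: eq_bigr => i _; rewrite /proj scalerBr scalerA.
  by rewrite addrC addrA addrAC.
(* The form a' composed with [proj]. *)
right; pose a'' := a' - (dot a' e / dot a e) *: a.
have a''E x : dot a'' x = dot a' (proj x).
  rewrite /a'' dotC dotBr dotZr ![dot x _]dotC /proj dotBr dotZr.
  by field.
have a''e : dot a'' e = 0.
  by rewrite a''E /proj divff // scale1r subrr -(scale0r 0) dotZr mul0r.
exists a'' => [i|]; last by rewrite a''E.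
case: (unliftP ord0 i) => [j|] ->; first by rewrite a''E; exact: a'd.
by rewrite -/e a''e.
Qed.

(** If each - d j lies in the cone, the sum of these relations has all
    coefficients at least 1; otherwise the form separating one - d j from the
    cone is negative at d j. *)
Lemma stiemke (m : nat) (d : 'I_m -> V) :
  (exists2 w : 'I_m -> R, forall i, 0 < w i & \sum_i w i *: d i = 0) \/
  (exists2 a, forall i, dot a (d i) <= 0 & exists i, dot a (d i) < 0).
Proof.
have [[j [a ad aj]]|H] := pselect (exists j, exists2 a,
    forall i, dot a (d i) <= 0 & 0 < dot a (- d j)).
  right; exists a => //; exists j; move: aj.
  by rewrite -scaleN1r dotZr mulN1r oppr_gt0.
have W j : exists2 w : 'I_m -> R, forall i, 0 <= w i & - d j = \sum_i w i *: d i.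
  by have [//|Ha] := farkas d (- d j); case: H; exists j.
left; pose w j := sval (cid2 (W j)).
have w0 j i : 0 <= w j i by rewrite /w; case: (cid2 _).
have wE j : - d j = \sum_i w j i *: d i by rewrite /w; case: (cid2 _).
exists (fun i => 1 + \sum_j w j i).
  by move=> i; rewrite ltr_pwDl // sumr_ge0.
under eq_bigr => i _ do rewrite scalerDl scale1r scaler_suml.
rewrite big_split /= exchange_big /=.
under [X in _ + X]eq_bigr => j _ do rewrite -wE.
by rewrite sumrN subrr.
Qed.

(** The theorem of the alternative for the vectors p i - x. *)
Lemma hull_interior_or_face (m : nat) (p : 'I_m -> V) x : hull p x ->
  intrinsic_interior (hull p) x \/
  exists G, [/\ is_face G (hull p), G x & exists2 y, hull p y & ~ G y].
Proof.
move=> xP; have [[w w0 wE]|[a ad [i ai]]] := stiemke (fun i => p i - x).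
  left; apply/intrinsic_interior_hullP.
  have m0 : (0 < m)%N.
    case: m p w w0 wE xP => // p _ _ _ [u [_ ]].
    by rewrite big_ord0 => /esym/eqP; rewrite oner_eq0.
  have W0 : 0 < \sum_i w i.
    rewrite (bigD1 (Ordinal m0)) //= ltr_pwDl // sumr_ge0 // => j _; exact: ltW.
  exists (fun i => w i / \sum_j w j); split.
  - by move=> i; rewrite divr_gt0.
  - by rewrite -mulr_suml divff // gt_eqF.
  - have : \sum_i w i *: p i = (\sum_i w i) *: x.
      apply/eqP; rewrite scaler_suml -subr_eq0 -sumrB -[X in _ == X]wE; apply/eqP.
      by apply: eq_bigr => j _; rewrite scalerBr.
    move=> E; under eq_bigr => j _ do rewrite mulrC -scalerA.
    by rewrite -scaler_sumr E scalerA mulVf ?scale1r // gt_eqF.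
right; exists (hull p `&` [set y | dot a y = dot a x]); split.
- exists a, (dot a x); split=> // y [w [w0 w1 ->]].
  rewrite -/(dot a _) dot_comb -[leRHS]mul1r -w1 mulr_suml ler_sum // => j _.
  by rewrite ler_wpM2l // -subr_le0 -dotBr.
- by split.
- exists (p i); first exact: hull_vertex.
  by move=> [_ /= E]; move: ai; rewrite dotBr E subrr ltxx.
Qed.

(** A supporting form that attains its maximum at x is constant on every segment
    that can be prolonged beyond x. *)
Lemma face_of_interior_point C G x :
  intrinsic_interior C x -> is_face G C -> G x -> G = C.
Proof.
move=> [xC xI] [a [b [Cb ->]]] [_ /= xb]; apply/seteqP; split=> [y []//|y yC].
split=> //=; apply/eqP; rewrite eq_le Cb //=.
have [e e0 /Cb] := xI y yC.
rewrite -/(dot a _) dotDr dotZr dotBr.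
have -> : dot a x = b by [].
by rewrite gerDl pmulr_rle0 // subr_le0.
Qed.
End Geometry.

(** * The cells of a subdivision through a point *)

Section Subdivision.
Variables (R : realType) (n : nat).
Local Notation V := 'rV[R]_n.
Local Open Scope classical_set_scope.
Variables (m : nat) (p : 'I_m -> V) (D : set (set V)).
Hypothesis subdiv : polyhedral_subdivision (hull p) D.
Implicit Types (F G : set V) (x : V).

(** A minimal cell through x is suitable, since the faces of a cell are cells.
    Minimality is measured by the number of cells contained in a cell. *)
Lemma cell_through_point x : hull p x -> exists2 F, D F & intrinsic_interior F x.
Proof.
have [/finite_seqP[s DE] polD faceD meetD covD] := subdiv.
move=> xP; pose below F := count (fun G => `[< G `<=` F >]) s.
have [F0 DF0 F0x] : exists2 F, D F & F x.
  by move: xP; rewrite -covD => -[F DF Fx]; exists F.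
have [k] := ubnP (below F0); elim: k F0 DF0 F0x => // k IH F DF Fx.
rewrite ltnS => lek; have [mF [q FE]] := polytope_hull (polD _ DF).
have [|xI|[G [GF Gx [y Fy nGy]]]] := @hull_interior_or_face R n mF q x.
- by rewrite -FE.
- by exists F => //; rewrite FE.
rewrite -FE in GF Fy.
have GsubF : G `<=` F by case: GF => a [b [_ ->]] z [].
have DG := faceD _ _ DF GF; apply: (IH G) => //.
apply: leq_trans lek; rewrite /below.
pose a H := `[< H `<=` G >]; pose b H := `[< H `<=` F >].
have -> : count b s = (count a s + count (predD b a) s)%N.
  rewrite -count_predUI [X in (_ + X)%N](eq_count (a2 := pred0)) => [|H /=].
    rewrite count_pred0 addn0; apply: eq_count => H /=.
    have [/asboolP HG|_] := boolP (a H); last by [].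
    by apply/asboolP; exact: subset_trans GsubF.
  by case: (a H).
rewrite -[X in (X < _)%N]addn0 ltn_add2l -has_count; apply/hasP; exists F.
  by move: DF; rewrite DE.
rewrite /=; apply/andP; split; last by apply/asboolP.
by apply/asboolPn => FG; apply/nGy/FG.
Qed.

(** The intersection is a face of both cells. *)
Lemma cell_through_point_unique F G x : D F -> D G ->
  intrinsic_interior F x -> intrinsic_interior G x -> F = G.
Proof.
have [_ _ _ meetD _] := subdiv.
move=> DF DG xF xG; have [FGF FGG] := meetD _ _ DF DG.
have FGx : (F `&` G) x by split; [case: xF|case: xG].
exact: etrans (esym (face_of_interior_point xF FGF FGx))
  (face_of_interior_point xG FGG FGx).
Qed.

(** If F meets the interior of the polytope at z, the segment from z to x can be
    prolonged within F, so x is a proper convex combination with z. *)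
Lemma interior_faceE F x : D F -> intrinsic_interior F x ->
  interior_face (hull p) D F <-> intrinsic_interior (hull p) x.
Proof.
have [_ _ _ _ covD] := subdiv.
move=> DF xF; have FP : F `<=` hull p by rewrite -covD => y Fy; exists F.
rewrite -rel_interior_hull; split=> [[_ nb]|xP]; last first.
  by split=> // Fb; have [Fx _] := xF; have [_ /(_ xP)] := Fb _ Fx.
have [z Fz zI] : exists2 z, F z & rel_interior (hull p) z.
  apply: contrapT => H; apply: nb => z Fz; split; first exact/subset_closure/FP.
  by move=> zI; apply: H; exists z.
rewrite rel_interior_hull in zI *; have [Fx xI] := xF.
have [e e0 /FP] := xI z Fz => Px.
have e1 : 0 < 1 + e by rewrite addr_gt0.
have -> : x = (e / (1 + e)) *: z + (1 + e)^-1 *: (x + e *: (x - z)).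
  by apply/rowP => j; rewrite !mxE; field; rewrite gt_eqF.
apply: intrinsic_interior_comb => //.
- by rewrite divr_gt0.
- by rewrite invr_ge0 ltW.
- by field; rewrite gt_eqF.
Qed.
End Subdivision.

(** * Matroid polytopes: interior, lattice sums, dimension *)

Section MatroidPolytope.
Variables (R : realType) (n : nat).
Local Notation V := 'rV[R]_n.
Local Open Scope classical_set_scope.
Implicit Types (F G : set V) (x : V).

Definition vertex (M : matroid 'I_n) (i : 'I_#|bases M|) : V :=
  basis_vector R (enum_val i).

Lemma basis_vectorE (B : {set 'I_n}) e : basis_vector R B 0 e = (e \in B)%:R.
Proof.
rewrite /basis_vector summxE (eq_bigr (fun i => (i == e)%:R)) => [|i _]; last first.
  by rewrite mxE eqxx eq_sym.
have [eB|eB] := boolP (e \in B).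
  by rewrite (bigD1 e) //= eqxx big1 ?addr0 // => i /andP[_ /negPf ->].
by rewrite big1 // => i iB; case: eqP iB eB => // -> ->.
Qed.

Lemma matroid_polytope_hull (M : matroid 'I_n) :
  matroid_polytope R M = hull (vertex (M := M)).
Proof.
rewrite -convex_hull_range; congr convex_hull; apply/seteqP; split=> x /=.
  move=> [B hB <-]; exists (enum_rank_in hB B) => //.
  by rewrite /vertex enum_rankK_in.
by move=> [i _ <-]; exists (enum_val i) => //; exact: enum_valP.
Qed.

Lemma matroid_polytope_interiorP (M : matroid 'I_n) (s : R) x : 0 < s ->
  intrinsic_interior (matroid_polytope R M) (s^-1 *: x) <->
  in_dilated_interior M s (fun e => x 0 e).
Proof.
move=> s0; have sn0 : s != 0 by rewrite gt_eqF.
rewrite matroid_polytope_hull; split.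
  move=> /intrinsic_interior_hullP[w [w0 w1 xE]].
  have /set0Pn[B0 hB0] := bases_neq0 M.
  exists (fun B => s * w (enum_rank_in hB0 B)); split.
  - by move=> B hB; rewrite mulr_gt0.
  - rewrite -mulr_sumr big_enum_val /= -[RHS]mulr1 -w1; congr (_ * _).
    by apply: eq_bigr => i _; rewrite enum_valK_in.
  - move=> e; have -> : x = s *: (s^-1 *: x) by rewrite scalerA divff ?scale1r.
    rewrite xE mxE summxE -mulr_sumr big_mkcondr big_enum_val /=; congr (_ * _).
    apply: eq_bigr => i _; rewrite enum_valK_in !mxE basis_vectorE.
    by case: ifP; rewrite ?mulr1 ?mulr0.
move=> [w [w0 ws wx]]; apply/intrinsic_interior_hullP.
exists (fun i => s^-1 * w (enum_val i)); split.
- by move=> i; rewrite mulr_gt0 ?invr_gt0 // w0 // enum_valP.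
- by rewrite -mulr_sumr -big_enum_val ws mulVf.
- under eq_bigr => i _ do rewrite -scalerA.
  rewrite -scaler_sumr; congr (_ *: _); apply/rowP => e.
  rewrite -wx summxE big_mkcondr big_enum_val; apply: eq_bigr => i _ /=.
  by rewrite mxE basis_vectorE; case: ifP; rewrite ?mulr1 ?mulr0.
Qed.

Definition point_of (k : nat) (x : {ffun 'I_n -> 'I_k.+1}) : V :=
  k%:R^-1 *: \row_e (x e)%:R.

(** The lattice sum is defined for arbitrary cells, since a priori only interior
    faces are matroid polytopes. *)
Definition cell_sum F (t : 'I_n -> R) (k : nat) : R :=
  \sum_(x : {ffun 'I_n -> 'I_k.+1} | `[< intrinsic_interior F (point_of x) >])
    \prod_e t e ^+ x e.

Lemma cell_sum_matroid (M : matroid 'I_n) t k : (0 < k)%N ->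
  cell_sum (matroid_polytope R M) t k = lattice_sum M t k.
Proof.
move=> k0; apply: eq_bigl => x; have k0' : 0 < k%:R :> R by rewrite ltr0n.
apply/asboolP/asboolP => [/(matroid_polytope_interiorP _ _ k0')|H].
  by apply: in_dilated_interior_ext => e; rewrite mxE.
apply/(matroid_polytope_interiorP _ _ k0').
by apply: in_dilated_interior_ext H => e; rewrite mxE.
Qed.

(** Each point of the interior of the polytope lies in the interior of exactly
    one interior face. *)
Lemma cell_sum_subdivision (m : nat) (p : 'I_m -> V) (D : set (set V))
    (I : seq (set V)) t k :
  polyhedral_subdivision (hull p) D -> uniq I ->
  [set` I] = [set F | interior_face (hull p) D F] ->
  cell_sum (hull p) t k = \sum_(F <- I) cell_sum F t k.
Proof.
move=> subdiv uI IE.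
have inI F : F \in I <-> interior_face (hull p) D F.
  by have := congr1 (fun A : set (set V) => A F) IE; rewrite /= => ->.
rewrite /cell_sum [LHS]big_mkcond.
under [RHS]eq_bigr => F _ do rewrite big_mkcond.
rewrite exchange_big; apply: eq_bigr => x _ /=.
case: asboolP => [xP|xnP].
  have [F DF xF] := cell_through_point subdiv (proj1 xP).
  have iF : interior_face (hull p) D F by apply/(interior_faceE subdiv DF xF).
  rewrite (bigD1_seq F) //=; last exact/inI.
  rewrite asboolT // [X in _ = _ + X]big_seq_cond [X in _ = _ + X]big1 ?addr0 //.
  move=> G /andP[GI /eqP GF]; case: asboolP => // xG; case: GF.
  have [DG _] := (inI G).1 GI.
  exact: cell_through_point_unique subdiv _ _ _ DG DF xG xF.
rewrite big_seq big1 // => F /inI iF; case: asboolP => // xF.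
by case: xnP; apply/(interior_faceE subdiv (proj1 iF) xF).
Qed.

Lemma hull_has_dim (m : nat) (p : 'I_m -> V) (i0 : 'I_m) :
  exists k, has_dim (hull p) k.
Proof.
pose X : m.-tuple V := [tuple p i - p i0 | i < m].
exists (\dim <<X>>%VS), (p i0), <<X>>%VS; split=> //.
rewrite affine_hull_hull; apply/seteqP; split=> x /=.
  move=> [w w1 ->].
  have -> : \sum_i w i *: p i - p i0 = \sum_i w i *: (p i - p i0).
    under [RHS]eq_bigr => i _ do rewrite scalerBr.
    by rewrite sumrB -scaler_suml w1 scale1r.
  apply: memv_suml => i _; apply: memvZ; apply: memv_span.
  by apply/mapP; exists i; rewrite ?mem_enum // mem_index_enum.
move=> xX; pose c (i : 'I_m) : R := coord X i (x - p i0).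
have xE : x - p i0 = \sum_(i < m) c i *: (p i - p i0).
  rewrite {1}(@coord_span _ V m X _ xX).
  apply: eq_bigr => i _.
  by rewrite -tnth_nth tnth_mktuple.
have d1 : \sum_(i < m) (i == i0)%:R = 1 :> R.
  by rewrite (bigD1 i0) //= eqxx big1 ?addr0 // => i /negPf ->.
have d2 (r : R) : \sum_(i < m) ((i == i0)%:R * r) *: p i = r *: p i0.
  rewrite (bigD1 i0) //= eqxx mul1r big1 ?addr0 // => i /negPf ->.
  by rewrite mul0r scale0r.
exists (fun i => c i + (i == i0)%:R * (1 - \sum_j c j)).
  by rewrite big_split /= -mulr_suml d1 mul1r addrC subrK.
under [RHS]eq_bigr => i _ do rewrite scalerDl.
rewrite big_split /= d2 scalerBl scale1r addrCA -[LHS](subrK (p i0)) addrC.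
congr (_ + _); rewrite scaler_suml -sumrB; apply: (etrans xE).
by apply: eq_bigr => i _; rewrite scalerBr.
Qed.

(** The forms that are constant on the points are the orthogonal complement of
    the direction space, of dimension n - k, and the pull-backs along kappa form
    a space of dimension c. *)
Lemma has_dim_from_constants (m : nat) (p : 'I_m -> V) (c k : nat)
    (kappa : 'I_n -> 'I_c) :
  (forall i, exists e, kappa e = i) ->
  (forall a : V, (forall i j, dot a (p i) = dot a (p j)) <->
     exists b, a 0 =1 b \o kappa) ->
  has_dim (hull p) k -> (k + c)%N = n.
Proof.
move=> ksurj kconst [x0 [U [aff <-]]].
rewrite affine_hull_hull in aff.
have affP x : (exists2 w : 'I_m -> R, \sum_i w i = 1 & x = \sum_i w i *: p i) <->
    x - x0 \in U.
  by have := congr1 (fun A : set V => A x) aff; rewrite /= => ->.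
have pU i : p i - x0 \in U.
  apply/affP; exists (fun j => (j == i)%:R).
    by rewrite (bigD1 i) //= eqxx big1 ?addr0 // => j /negPf ->.
  rewrite (bigD1 i) //= eqxx scale1r big1 ?addr0 // => j /negPf ->.
  by rewrite scale0r.
have orthP (a : V) : (forall u, u \in U -> dot a u = 0) <->
    (forall i j, dot a (p i) = dot a (p j)).
  split=> [H i j|H u uU].
    apply/eqP; rewrite -subr_eq0 -dotBr; apply/eqP/H.
    have -> : p i - p j = (p i - x0) - (p j - x0) by rewrite opprB addrA subrK.
    exact: memvB.
  have /affP[w w1 wE] : (x0 + u) - x0 \in U by rewrite addrC addKr.
  have /affP[w' w'1 w'E] : x0 - x0 \in U by rewrite subrr mem0v.
  have -> : u = (x0 + u) - x0 by rewrite addrC addKr.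
  rewrite dotBr wE [in X in _ - X]w'E !dot_comb.
  case: (posnP m) => [m0|m0].
    by move: w1; rewrite big_pred0 => [/esym/eqP|[i]]; rewrite ?oner_eq0 // m0.
  pose i0 := Ordinal m0.
  under eq_bigr => i _ do rewrite (H i i0).
  under [X in _ - X]eq_bigr => i _ do rewrite (H i i0).
  by rewrite -!mulr_suml w1 w'1 subrr.
pose d := \dim U; pose B := \matrix_(i < d, j < n) (vbasis U)`_i 0 j : 'M[R]_(d, n).
have rowB i : row i B = (vbasis U)`_i by apply/rowP => j; rewrite !mxE.
have rB : \rank B = d.
  apply/eqP; apply: inj_row_free => v vB.
  have /freeP H := basis_free (vbasisP U).
  apply/rowP => i; rewrite mxE; apply: (H (fun i => v 0 i)).
  by rewrite -[RHS]vB mulmx_sum_row; apply: eq_bigr => j _; rewrite rowB.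
have kerP (a : V) : (a <= kermx B^T)%MS <-> exists b, a 0 =1 b \o kappa.
  rewrite -kconst -orthP; split=> [/sub_kermxP aB u uU|H].
    rewrite (coord_vbasis uU) dot_sumr big1 // => i _; rewrite dotZr.
    have /rowP/(_ i) := aB; rewrite !mxE => E.
    rewrite (_ : dot a _ = 0) ?mulr0 // -[RHS]E /dot; apply: eq_bigr => j _.
    by rewrite !mxE.
  apply/sub_kermxP/rowP => i; rewrite !mxE.
  rewrite -[RHS](H (vbasis U)`_i) ?vbasis_mem ?mem_nth ?size_tuple //.
  by apply: eq_bigr => j _; rewrite !mxE.
pose K := \matrix_(i < c, e < n) (kappa e == i)%:R : 'M[R]_(c, n).
have bK (b : 'rV[R]_c) e : (b *m K) 0 e = b 0 (kappa e).
  rewrite mxE (bigD1 (kappa e)) //= mxE eqxx mulr1 big1 ?addr0 // => i.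
  by rewrite mxE eq_sym => /negPf ->; rewrite mulr0.
have rK : \rank K = c.
  apply/eqP; apply: inj_row_free => v vK; apply/rowP => i.
  by have [e <-] := ksurj i; rewrite -bK vK !mxE.
have : \rank (kermx B^T) = \rank K.
  apply/eqP; rewrite eqn_leq; apply/andP; split; apply: mxrankS; apply/rV_subP => a.
    move=> /kerP[b ab]; apply/submxP; exists (\row_i b i); apply/rowP => e.
    by rewrite bK mxE ab.
  move=> /submxP[b ->]; apply/kerP; exists (b 0) => e; exact: bK.
rewrite mxrank_ker mxrank_tr rB rK => <-; rewrite subnKC //.
by have := rank_leq_col B; rewrite rB.
Qed.

Lemma sum_of_series_parallel_has_dim (N : matroid 'I_n) (c : nat)
    (E : 'I_c -> finType) (M : forall i, matroid (E i)) k :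
  (forall i, series_parallel (M i)) -> matroid_iso (direct_sum M) N ->
  has_dim (matroid_polytope R N) k <-> (k + c)%N = n.
Proof.
move=> spM isoN; rewrite matroid_polytope_hull.
have /set0Pn[B0 hB0] := bases_neq0 N.
have [kappa [ksurj kconst]] := constant_on_components R spM isoN.
have dotv (a : V) i : dot a (vertex i) = \sum_(e in enum_val i) a 0 e.
  rewrite /dot [RHS]big_mkcond; apply: eq_bigr => e _; rewrite basis_vectorE.
  by case: ifP; rewrite ?mulr1 ?mulr0.
have const (a : V) : (forall i j : 'I_#|bases N|, dot a (vertex i) = dot a (vertex j)) <->
    exists b, a 0 =1 b \o kappa.
  rewrite -kconst; split=> [H B B' hB hB'|H i j].
    have := H (enum_rank_in hB B) (enum_rank_in hB B').
    by rewrite !dotv !enum_rankK_in.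
  by rewrite !dotv; apply: H; exact: enum_valP.
split; first exact: has_dim_from_constants ksurj const.
have [k' hk'] := hull_has_dim (@vertex N) (enum_rank_in hB0 B0).
have k'n := has_dim_from_constants ksurj const hk'.
move=> kn; suff -> : k = k' by [].
by apply/eqP; rewrite -(eqn_add2r c) kn k'n.
Qed.
End MatroidPolytope.

(** * Counting interior faces *)

Lemma card_eq_uniq_seq (T : choiceType) (s s' : seq T) :
  uniq s -> uniq s' -> size s = size s' -> ([set` s]%classic #= [set` s']%classic)%card.
Proof.
move=> us us' ss'; apply/fcard_eq; [exact: finite_seq|exact: finite_seq|].
have sizeE (r : seq T) : uniq r -> size (finmap.enum_fset (fset_set [set` r]%classic)) = size r.
  move=> ur; apply/perm_size/uniq_perm => // x.
  transitivity (x \in [set` r]%classic); first exact: (in_fset_set (finite_seq r) x).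
  by apply/idP/idP; rewrite inE.
by rewrite !sizeE.
Qed.

Section Main.
Variables (R : realType) (n : nat).
Local Notation V := 'rV[R]_n.
Local Open Scope classical_set_scope.

Definition has_components (F : set V) (c : nat) : Prop :=
  exists (N : matroid 'I_n) (E : 'I_c -> finType) (M : forall i, matroid (E i)),
    [/\ F = matroid_polytope R N, forall i, series_parallel (M i)
      & matroid_iso (direct_sum M) N].

Lemma has_components_dim F c k : has_components F c ->
  has_dim F k <-> (k + c)%N = n.
Proof. by move=> [N [E [M [-> spM iso]]]]; exact: sum_of_series_parallel_has_dim iso. Qed.

Lemma has_components_localizes F c u v t : has_components F c ->
  (forall e, t e != 0) -> injective t ->
  localizes_to u v t finset.setT (cell_sum F t) ((-1) ^+ n * (u * v - 1) ^+ c).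
Proof.
move=> [N [E [M [-> spM iso]]]] t0 injt.
have := sum_of_series_parallel_localizes spM iso u v t0 injt; rewrite card_ord.
by apply: localizes_to_ext => k k0; rewrite cell_sum_matroid.
Qed.

(** Choosing u = y + 1 and v = 1 gives uv - 1 = y. *)
Lemma subdivision_interior_faces (M : matroid 'I_n) (D : set (set V)) :
  polyhedral_subdivision (matroid_polytope R M) D ->
  (forall F, interior_face (matroid_polytope R M) D F ->
     exists2 N : matroid 'I_n, corresponds_to F N & sum_of_series_parallel N) ->
  exists (I : seq (set V)) (c : set V -> nat),
    [/\ uniq I, [set` I] = [set F | interior_face (matroid_polytope R M) D F],
        forall F, F \in I -> has_components F (c F)
      & forall y t, separating t ->
        localizes_to (y + 1) 1 t finset.setT (cell_sum (matroid_polytope R M) t)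
          ((-1) ^+ n * \sum_(F <- I) y ^+ c F)].
Proof.
move=> subdiv sp; set P := matroid_polytope R M in subdiv sp *.
have finI : finite_set [set F | interior_face P D F].
  by case: subdiv => finD _ _ _ _; apply: sub_finite_set finD => F [].
have [I0 I0E] := (finite_seqP _).1 finI; pose I := undup I0.
have IE : [set` I] = [set F | interior_face P D F].
  by rewrite I0E; apply/seteqP; split=> F /=; rewrite mem_undup.
have inI F : F \in I -> interior_face P D F.
  by have := congr1 (fun A : set (set V) => A F) IE; rewrite /= => <-.
have H F : exists c, F \in I -> has_components F c.
  have [/inI/sp[N FN [c [E [L [_ spL iso]]]]]|_] := boolP (F \in I); last by exists 0%N.
  by exists c => _; exists N, E, L.
have [c cP] := choice H; exists I, c; split=> //; first exact: undup_uniq.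
move=> y t sept; have [_ t0] := sept.
have := @localizes_to_sum R _ (y + 1) 1 t finset.setT _ I (fun F => cell_sum F t)
  (fun F => (-1) ^+ n * y ^+ c F).
rewrite mulr_sumr => /(_ _)/localizes_to_ext; apply=> [k k0|F FI].
  rewrite /P matroid_polytope_hull in subdiv IE *.
  by rewrite (cell_sum_subdivision _ _ subdiv (undup_uniq I0) IE).
have := has_components_localizes (y + 1) 1 (cP F FI) t0 (separating_inj sept).
by rewrite mulr1 addrK.
Qed.
End Main.

Local Open Scope classical_set_scope.
Local Open Scope card_scope.

Theorem proposition1p1 (R : realType) (n d : nat) (M : matroid 'I_n)
  (rank_M : matroid_rank M = d)
  (D D' : set (set 'rV[R]_n))
  (subdiv_D : polyhedral_subdivision (matroid_polytope R M) D)
  (subdiv_D' : polyhedral_subdivision (matroid_polytope R M) D')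
  (sp_D : forall F, interior_face (matroid_polytope R M) D F ->
     exists2 N : matroid 'I_n, corresponds_to F N & sum_of_series_parallel N)
  (sp_D' : forall F, interior_face (matroid_polytope R M) D' F ->
     exists2 N : matroid 'I_n, corresponds_to F N & sum_of_series_parallel N) :
  forall k : nat,
    [set F | interior_face (matroid_polytope R M) D F /\ has_dim F k] #=
    [set F | interior_face (matroid_polytope R M) D' F /\ has_dim F k].
Proof.
have [I [c [uI IE Ic IV]]] := subdivision_interior_faces subdiv_D sp_D.
have [I' [c' [uI' IE' Ic' IV']]] := subdivision_interior_faces subdiv_D' sp_D'.
have sums (y : R) : (\sum_(F <- I) y ^+ c F = \sum_(F <- I') y ^+ c' F)%R.
  have sept := separating_exists R n.
  have := localizes_to_unique sept (fun k _ => erefl) (IV y _ sept) (IV' y _ sept).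
  by apply: mulfI; rewrite signr_eq0.
have counts := count_from_power_sums sums.
have faceE (J : seq (set 'rV[R]_n)) (e : set 'rV[R]_n -> nat) (DD : set (set 'rV[R]_n)) k :
    [set` J] = [set F | interior_face (matroid_polytope R M) DD F] ->
    (forall F, F \in J -> has_components F (e F)) ->
    [set F | interior_face (matroid_polytope R M) DD F /\ has_dim F k] =
    [set` [seq F <- J | (k + e F == n)%N]].
  move=> JE Je; have inJ F : F \in J <-> interior_face (matroid_polytope R M) DD F.
    by have := congr1 (fun A : set (set _) => A F) JE; rewrite /= => ->.
  apply/seteqP; split=> F /=; rewrite mem_filter.
    by move=> [/inJ FJ /(has_components_dim _ (Je _ FJ)) ->]; rewrite eqxx.
  move=> /andP[/eqP kn FJ]; split; first exact/inJ.
  exact/(has_components_dim _ (Je _ FJ)).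
move=> k; rewrite (faceE _ _ _ k IE Ic) (faceE _ _ _ k IE' Ic').
apply: card_eq_uniq_seq; rewrite ?filter_uniq // !size_filter.
have [kn|nk] := leqP k n.
  have cE (e : set 'rV[R]_n -> nat) J :
      count (fun F => k + e F == n)%N J = count (fun F => e F == n - k)%N J.
    by apply: eq_count => F; rewrite -[in LHS](subnKC kn) eqn_add2l.
  by rewrite !cE counts.
have c0 (e : set 'rV[R]_n -> nat) J : count (fun F => k + e F == n)%N J = 0%N.
  rewrite (eq_count (a2 := pred0)) ?count_pred0 // => F.
  by apply/negbTE; rewrite gtn_eqF // ltn_addr.
by rewrite !c0.
Qed.
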